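(* Let $\Omega\subset\mathbb{R}^2$ be a convex polygon with $0\in\mathrm{int}\,\Omega$. Let $\theta^\circ(t)$ be a solution of the generalized pendulum equation $$\ddot\theta^\circ=\sin_\Omega\theta ,$$ and let $\theta(t)$ be a function such that $\theta(t)\leftrightarrow\theta^\circ(t)$ and $\ddot\theta^\circ(t)=\sin_\Omega\theta(t)$ for a.e. $t$. Then the function $\theta(t)$ is a.e. piecewise-constant up to the period $2\mathbb{S}(\Omega)$.
   Context: Notation. For a convex compact set $\Omega\subset\mathbb{R}^2$ with $0\in\mathrm{int}\,\Omega$, let $\mathbb{S}(\Omega)$ denote its area. Generalized trigonometric functions: for $0\le\theta<2\mathbb{S}(\Omega)$ let $P_\theta\in\partial\Omega$ be the boundary point such that the sector of $\Omega$ swept counterclockwise from the ray $Ox$ (the positive $x$-axis) to the ray $OP_\theta$ has area $\frac12\theta$. Extend $P_\theta$ to all $\theta\in\mathbb{R}$ periodically with period $2\mathbb{S}(\Omega)$. Then $\cos_\Omega\theta$ and $\sin_\Omega\theta$ are by definition the coordinates of $P_\theta$: $P_\theta=(\cos_\Omega\theta,\sin_\Omega\theta)$. The polar set is $\Omega^\circ=\{(p,q)\in\mathbb{R}^2: px+qy\le 1\text{ for all }(x,y)\in\Omega\}$; it is again convex and compact with $0\in\mathrm{int}\,\Omega^\circ$, so $\cos_{\Omega^\circ},\sin_{\Omega^\circ}$ are defined by the same construction; write $Q_\psi=(\cos_{\Omega^\circ}\psi,\sin_{\Omega^\circ}\psi)\in\partial\Omega^\circ$ for $\psi\in\mathbb{R}$.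 Correspondence: for $\theta,\theta^\circ\in\mathbb{R}$, $\theta\leftrightarrow\theta^\circ$ means that the covector $Q_{\theta^\circ}$ determines a supporting half-plane of $\Omega$ at $P_\theta$, i.e. $\langle Q_{\theta^\circ},P_\theta\rangle=\max_{P\in\Omega}\langle Q_{\theta^\circ},P\rangle$. Solution: a real-valued function $\theta^\circ(t)$ on a time interval is a solution of $\ddot\theta^\circ=\sin_\Omega\theta$ if it is Lipschitz continuous together with its derivative and there exists a function $\theta(t)$ such that both $\theta(t)\leftrightarrow\theta^\circ(t)$ and $\ddot\theta^\circ(t)=\sin_\Omega\theta(t)$ hold for a.e. $t$. ''A.e. piecewise-constant up to the period $2\mathbb{S}(\Omega)$'' means: every compact subinterval of the time interval can be partitioned into finitely many intervals such that on each of them the class of $\theta(t)$ in $\mathbb{R}/2\mathbb{S}(\Omega)\mathbb{Z}$ is equal to a constant for a.e. $t$. *)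

(* Defs.v *)
From mathcomp Require Import all_boot all_order all_algebra.
From mathcomp Require Import all_classical all_reals all_analysis.

Set Implicit Arguments.
Unset Strict Implicit.
Unset Printing Implicit Defensive.

Import Order.TTheory GRing.Theory Num.Theory.
Import numFieldNormedType.Exports.

Local Open Scope classical_set_scope.
Local Open Scope ring_scope.

Section pendulum.
Context {R : realType}.
Implicit Types (Omega : set (R * R)) (I : interval R).

(* Convex hull of a finite set; nondegeneracy is left to the hypothesis that 0
   is an interior point. *)
Definition convex_polygon Omega : Prop :=
  exists V : set (R * R), finite_set V /\
    Omega = smallest (@convex_set R (R * R)%type) V.

Definition area2 (A : set (R * R)) : \bar R :=
  ((@lebesgue_measure R) \x (@lebesgue_measure R))%E A.

Definition area Omega : R := fine (area2 Omega).

Definition period Omega : R := 2 * area Omega.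

Definition boundary Omega : set (R * R) := closure Omega `\` Omega°.

Definition polar_pt (r phi : R) : R * R := (r * cos phi, r * sin phi).

(* The part of Omega swept counterclockwise from the ray Ox to the ray with
   polar angle alpha, for 0 <= alpha < 2 pi. *)
Definition sector Omega (alpha : R) : set (R * R) :=
  [set p | Omega p /\
    exists r phi : R, [/\ 0 <= r, 0 <= phi <= alpha & p = polar_pt r phi]].

(* P is the point P_theta, for 0 <= theta < 2 S(Omega). *)
Definition is_trig_point Omega (theta : R) (P : R * R) : Prop :=
  boundary Omega P /\
  exists r alpha : R, [/\ 0 < r, 0 <= alpha < 2 * pi, P = polar_pt r alpha &
    area2 (sector Omega alpha) = (theta / 2)%:E].

Definition reduce_mod (T theta : R) : R :=
  theta - (Num.floor (theta / T))%:~R * T.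

(* The point P_theta for every real theta. When Omega is convex and compact with
   0 in its interior, [is_trig_point] determines it uniquely; the default value
   (0, 0) is irrelevant. *)
Definition trig_point Omega (theta : R) : R * R :=
  xget (0, 0) [set P | is_trig_point Omega (reduce_mod (period Omega) theta) P].

Definition cosO Omega (theta : R) : R := (trig_point Omega theta).1.
Definition sinO Omega (theta : R) : R := (trig_point Omega theta).2.

Definition pairing (q p : R * R) : R := q.1 * p.1 + q.2 * p.2.

Definition polar_set Omega : set (R * R) :=
  [set q | forall p, Omega p -> pairing q p <= 1].

(* theta <-> theta°: the covector Q_{theta°} attains its maximum over Omega at
   P_theta, a point of Omega since it lies on the boundary of a closed set. *)
Definition corresponds Omega (theta thetao : R) : Prop :=
  let Q := (cosO (polar_set Omega) thetao, sinO (polar_set Omega) thetao) in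
  let Pt := (cosO Omega theta, sinO Omega theta) in
  forall P, Omega P -> pairing Q P <= pairing Q Pt.

(* Functions of time are total; only their values on I matter. *)
Definition accompanies Omega I (thetao theta : R -> R) : Prop :=
  {ae lebesgue_measure, forall t : R, t \in I ->
    corresponds Omega (theta t) (thetao t) /\
    is_derive t 1 (derive1 thetao) (sinO Omega (theta t))}.

(* The derivative is taken at interior points of I only: being Lipschitz there,
   it extends to the endpoints, with the one-sided derivatives as values. *)
Definition pendulum_solution Omega I (thetao : R -> R) : Prop :=
  [/\ [lipschitz thetao t | t in [set` I]],
      forall t : R, [set` I]° t -> derivable thetao t 1,
      [lipschitz (derive1 thetao) t | t in [set` I]°] &
      exists theta : R -> R, accompanies Omega I thetao theta].

Definition ae_piecewise_constant_mod (T : R) I (theta : R -> R) : Prop :=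
  forall a b : R, a <= b -> `[a, b] `<=` [set` I] ->
    exists (n : nat) (J : 'I_n -> interval R),
      partition [set: 'I_n] (fun i => [set` J i]) `[a, b] /\
      forall i, exists c : R, {ae lebesgue_measure, forall t : R, t \in J i ->
        exists k : int, theta t = c + k%:~R * T}.

End pendulum.

(* Main.v *)
Require Import Defs.
From mathcomp Require Import all_boot all_order all_algebra.
From mathcomp Require Import all_classical all_reals all_analysis.
From mathcomp Require Import measurable_realfun.
From mathcomp Require Import ring lra.

(** Fix a time [s] and put [u = thetao - thetao s].  When [thetao] is slightly
    above [thetao s], the covector Q_thetao has a direction at which one and
    the same vertex Bp of Omega is the only maximiser, so P_theta = Bp;
    slightly below, P_theta is another fixed vertex Bn.  Hence [u'' = Bp.2]
    almost everywhere on [u > 0] and [u'' = Bn.2] almost everywhere on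
    [u < 0].  The theorem says that the switchings between the signs of [u]
    cannot accumulate.

    This is forced by the energy [u'^2 / 2 - W u], where [W] is the
    primitive of the force, with slopes Bn.2 and Bp.2: it is constant, because on
    [u > 0] and on [u < 0] the motion is a parabola, while at a time with
    [u = u' = 0] both terms vanish to second order ([energy_cst]).
    If [u'] has a nonzero limit at [s], then [u] has a constant sign next to
    [s].  Otherwise the energy is zero.  If then [u] became positive and
    returned to 0, at its maximum [u' = 0] and [W u = 0], so Bp.2 = 0, so
    [u' = 0] wherever [u > 0], and [u] could never have left 0.  So just after
    [s], and by time reversal just before, [u] vanishes identically or has a
    constant sign ([relay_trichotomy]).  A constant sign makes P_theta a fixed
    vertex.  If [u = 0] on an interval, then [u'' = 0] there, so P_theta is on
    the x-axis and on the supporting line of a fixed covector, which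
    determines it ([corresponds_zero]).  In both cases the class of theta is
    determined by P_theta, and the compactness of the time interval, in the
    form of real induction, gives the finite partition.

    The geometric input is [exposes_right] and [exposes_left].  The area of a
    sector of the polar set depends on its angle in a Lipschitz way
    ([sector_step]), so the intermediate value theorem shows that every
    Q_psi exists; comparing areas, its polar angle is strictly increasing in
    psi on a period.  A strictly monotone function has one-sided limits that it
    does not attain, and this is all that is needed: ordering the vertices
    lexicographically by the value of the linear form at the limit direction
    and by its derivative in the angle singles out the vertex that wins for
    all directions slightly beyond ([maximizer_near_direction]).

    The equation holds only almost everywhere; it is used through the fact
    that a Lipschitz function with null derivative almost everywhere is
    constant ([lipschitz_ae_derive0_cst]). *)

Set Implicit Arguments.
Unset Strict Implicit.
Unset Printing Implicit Defensive.

Import Order.TTheory GRing.Theory Num.Theory.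
Import numFieldNormedType.Exports.

Local Open Scope classical_set_scope.
Local Open Scope ring_scope.

(** * Real induction and Lipschitz functions with null derivative *)

Section line.
Context {R : realType}.
Implicit Types (a b c d e s t : R).

(** The compactness of a segment in inductive form: a property that holds at
    [a], propagates a little to the right, and passes to limits from the left,
    reaches [b]. *)
Lemma real_induction (D : R -> Prop) a b : a <= b -> D a ->
  (forall s, a <= s < b -> D s -> exists2 s', s < s' <= b & D s') ->
  (forall s, a < s <= b ->
    (forall e, 0 < e -> exists s', [/\ a <= s', s - e < s', s' < s & D s']) ->
    D s) ->
  D b.
Proof.
move=> ab Da Dright Dleft.
pose E := [set s | a <= s <= b /\ D s].
have E0 : E !=set0 by exists a; rewrite /E/= lexx ab.
have ubE : ubound E b by move=> s [/andP[]].
have hsE : has_sup E by split=> //; exists b.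
have supb : sup E <= b by exact: ge_sup.
have asup : a <= sup E by apply: ub_le_sup; [exists b|rewrite /E/= lexx ab].
have DE : D (sup E).
  have [//|nD] := pselect (D (sup E)).
  apply: Dleft => [|e e0].
    rewrite supb andbT lt_neqAle asup andbT; apply/eqP => aE.
    by apply: nD; rewrite -aE.
  have [s [/andP[as_ sb] Ds] es] := sup_adherent e0 hsE.
  exists s; split=> //; rewrite lt_neqAle; apply/andP; split.
    by apply/eqP => sE; apply: nD; rewrite -sE.
  by apply: ub_le_sup; [exists b|rewrite /E/= as_ sb].
have [sb|bs] := ltP (sup E) b; last by rewrite (@le_anti _ _ b (sup E)) ?bs.
have [|s' /andP[ss' s'b] Ds'] := Dright _ _ DE; first by rewrite asup.
suff : s' <= sup E by rewrite leNgt ss'.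
apply: ub_le_sup; first by exists b.
by rewrite /E/= s'b (le_trans asup (ltW ss')).
Qed.

Lemma is_derive0_bound (h : R -> R) t e : is_derive t 1 h 0 -> 0 < e ->
  exists2 d, 0 < d & forall s, `|s - t| < d -> `|h s - h t| <= e * `|s - t|.
Proof.
move=> dh e0.
have [dh1 dh2] := dh.
have : (fun k : R => k^-1 *: (h (k *: 1 + t) - h t)) @ 0^' --> (0:R).
  by rewrite -[X in _ --> X]dh2; exact: dh1.
move=> /cvgr0Pnorm_le /(_ _ e0) /= [d /= d0 Hd].
exists d => // s sd.
have [->|st] := eqVneq s t; first by rewrite !subrr normr0 mulr0.
have st0 : s - t != 0 by rewrite subr_eq0.
have := Hd (s - t); rewrite /ball_/= sub0r normrN => /(_ sd st0).
rewrite [_ *: 1]mulr1 subrK normrZ normfV mulrC ler_pdivrMr ?normr_gt0//.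
Qed.

(** The carrier of [lebesgue_measure] is a type of generated sigma-algebra,
    convertible to [R]; this lemma and the next restate two filter laws for
    predicates on [R] itself. *)
Lemma ae_imp (P Q : R -> Prop) : (forall t, P t -> Q t) ->
  {ae lebesgue_measure, forall t : R, P t} ->
  {ae lebesgue_measure, forall t : R, Q t}.
Proof.
move=> PQ; exact: (@filterS _ _
  (ae_filter_ringOfSetsType (@lebesgue_measure R)) P Q PQ).
Qed.

Lemma ae_and (P Q : R -> Prop) : 
  {ae lebesgue_measure, forall t : R, P t} ->
  {ae lebesgue_measure, forall t : R, Q t} ->
  {ae lebesgue_measure, forall t : R, P t /\ Q t}.
Proof.
exact: (@filterI _ _ (ae_filter_ringOfSetsType (@lebesgue_measure R)) P Q).
Qed.
Lemma ae_itv_closed (P : R -> Prop) c d :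
  {ae lebesgue_measure, forall t : R, t \in `]c, d[ -> P t} ->
  {ae lebesgue_measure, forall t : R, t \in `[c, d] -> P t}.
Proof.
move=> Pcd.
have ae1 x : {ae lebesgue_measure, forall t : R, t != x}.
  exists [set x]; split => //; first exact: lebesgue_measure_set1.
  by move=> t /= /negP; rewrite negbK => /eqP.
apply: ae_imp (ae_and Pcd (ae_and (ae1 c) (ae1 d))) => t [Pt [tc td]].
rewrite in_itv/= => /andP[ct tdl]; apply: Pt.
by rewrite in_itv/= !lt_neqAle ct tdl td eq_sym tc.
Qed.

(** Cover the exceptional null set by an open [U] of measure less than [e].
    Inside [U] the Lipschitz bound controls the increments of [h] by the
    measure of [U]; elsewhere the derivative is 0 and they are controlled by
    [e] times the length.  Real induction adds up these local bounds. *)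
Lemma lipschitz_ae_derive0_cst (h : R -> R) (L c d : R) : 0 <= L ->
  (forall s t, s \in `[c, d] -> t \in `[c, d] -> `|h s - h t| <= L * `|s - t|) ->
  {ae lebesgue_measure, forall t : R, t \in `]c, d[ -> is_derive t 1 h 0} ->
  forall s t, s \in `[c, d] -> t \in `[c, d] -> h s = h t.
Proof.
move=> L0 hL /ae_itv_closed[N [mN N0 hN]] s t.
wlog st : s t / s <= t.
  by move=> wl scd tcd; have [/wl|/ltW/wl H] := leP s t; [apply|rewrite H].
move=> scd tcd.
suff H e : 0 < e -> `|h t - h s| <= L * e + e * (t - s).
  apply/esym/eqP; rewrite -subr_eq0 -normr_eq0 eq_le normr_ge0 andbT.
  rewrite leNgt; apply/negP => h0.
  have k0 : 0 < L + (t - s) + 1 by have := subr_ge0 s t; rewrite st; lra.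
  have [e e0 he] : exists2 e, 0 < e & e * (L + (t - s) + 1) = `|h t - h s| / 2.
    exists (`|h t - h s| / 2 / (L + (t - s) + 1)); first by rewrite !divr_gt0.
    by rewrite divfK// gt_eqF.
  by have := H _ e0; lra.
move=> e0.
have Noo : (lebesgue_measure N < +oo)%E by rewrite (N0 : lebesgue_measure N = 0%E).
have [U [oU NU Ue]] := lebesgue_regularity_outer mN Noo e0.
have mU : measurable U by exact: open_measurable.
have {}Ue : (lebesgue_measure U < e%:E)%E.
  rewrite -(setDUK NU) (le_lt_trans (measureU2 _ mN (measurableD mU mN)))//.
  by rewrite [X in (X + _ < _)%E](_ : _ = 0%E) ?add0e//; exact: N0.
pose m x : \bar R := lebesgue_measure (U `&` `]s, x]).
have mm x : (0 <= m x)%E by exact: measure_ge0.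
have mUs x : measurable (U `&` `]s, x]) by exact: measurableI.
have mmono x y : x <= y -> (m x <= m y)%E.
  move=> xy; apply: le_measure; rewrite ?inE; [exact: mUs|exact: mUs|].
  by apply: classical_sets.setIS; apply: subset_itvl; rewrite bnd_simp.
have me x : (m x <= e%:E)%E.
  apply/ltW; apply: le_lt_trans Ue.
  by apply: le_measure; rewrite ?inE; [exact: mUs|exact: mU|exact: subIsetl].
have mfin x : m x \is a fin_num.
  by rewrite ge0_fin_numE// (le_lt_trans (me x))// ltry.
have fmono x y : x <= y -> fine (m x) <= fine (m y).
  by move=> xy; rewrite fine_le// mmono.
have inst x : s <= x <= t -> x \in `[c, d].
  move=> /andP[sx xt]; move: scd tcd; rewrite !in_itv/= => /andP[cs _] /andP[_ td].
  by rewrite (le_trans cs sx) (le_trans xt td).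
pose D x := `|h x - h s| <= L * fine (m x) + e * (x - s).
suff Dt : D t.
  apply: (le_trans Dt); rewrite lerD2r ler_wpM2l//.
  by rewrite -lee_fin fineK.
apply: (@real_induction D s t) => //.
- by rewrite /D !subrr normr0 mulr0 addr0 mulr_ge0// fine_ge0.
- move=> x /andP[sx xt] Dx.
  have [Ux|nUx] := pselect (U x).
    have [r /= r0 Hr] : nbhs x U by move: Ux; exact: oU.
    pose y := Num.min (x + r / 2) t.
    have xy : x < y by rewrite lt_min xt andbT ltrDl divr_gt0.
    have yt : y <= t by rewrite ge_min lexx orbT.
    have yr : y <= x + r / 2 by rewrite ge_min lexx.
    exists y; first by rewrite xy.
    have my : m y = (m x + (y - x)%:E)%E.
      have yE : U `&` `]s, y] = (U `&` `]s, x]) `|` `]x, y].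
        apply/seteqP; split=> z /=; rewrite !in_itv/=.
          move=> [Uz /andP[sz zy]].
          by have [zx|xz] := leP z x; [left; rewrite sz|right].
        move=> [[Uz /andP[sz zx]]|/andP[xz zy]].
          by split=> //; rewrite sz (le_trans zx (ltW xy)).
        split; last by rewrite (le_lt_trans sx xz).
        by apply: Hr; rewrite /= ltr_norml; apply/andP; split; lra.
      have disj : (U `&` `]s, x]) `&` `]x, y] = set0.
        by apply/seteqP; split=> // z []/= [_]; rewrite !in_itv/=; lra.
      have := measureU lebesgue_measure (mUs x) (measurable_itv `]x, y]) disj.
      rewrite -yE => myE; apply: (eq_trans myE); congr (_ + _)%E.
      by have := lebesgue_measure_itv `]x, y]; rewrite /= lte_fin xy; apply.
    have hxy : `|h y - h x| <= L * (y - x).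
      rewrite -[X in L * X]ger0_norm ?subr_ge0 ?(ltW xy)//.
      apply: hL; apply: inst; rewrite ?sx ?(ltW xt)/= ?yt ?(le_trans sx (ltW xy))//.
    rewrite /D my fineD//= mulrDr.
    have -> : h y - h s = (h y - h x) + (h x - h s) by ring.
    rewrite (le_trans (ler_normD _ _))//; move: Dx; rewrite /D.
    by have := ler_wpM2l (ltW e0) (ltW xy); rewrite !mulrBr; lra.
  have dx : is_derive x 1 h 0.
    have [//|ndx] := pselect (is_derive x 1 h 0); exfalso; apply/nUx/NU/hN => /=.
    by move=> /(_ (inst x _)); rewrite sx ltW// => /(_ isT).
  have [r r0 Hr] := is_derive0_bound dx e0.
  pose y := Num.min (x + r / 2) t.
  have xy : x < y by rewrite lt_min xt andbT ltrDl divr_gt0.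
  have yt : y <= t by rewrite ge_min lexx orbT.
  have yr : y <= x + r / 2 by rewrite ge_min lexx.
  exists y; first by rewrite xy.
  have := Hr y; rewrite ger0_norm ?subr_ge0 ?(ltW xy)// => hyxW; have hyx := hyxW ltac:(lra).
  rewrite /D; have -> : h y - h s = (h y - h x) + (h x - h s) by ring.
  rewrite (le_trans (ler_normD _ _))//; move: Dx; rewrite /D.
  by have := ler_wpM2l L0 (fmono _ _ (ltW xy)); lra.
- move=> x /andP[sx xt] Dapp; rewrite /D.
  apply/ler_addgt0Pr => f f0.
  have fL : 0 < f / (L + 1) by rewrite divr_gt0// ltr_wpDl.
  have [y [sy xy yx Dy]] := Dapp _ fL.
  have -> : h x - h s = (h x - h y) + (h y - h s) by ring.
  rewrite (le_trans (ler_normD _ _))//.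
  have : `|h x - h y| <= L * (x - y).
    rewrite -[X in L * X]ger0_norm ?subr_ge0 ?(ltW yx)//.
    by apply: hL; apply: inst; rewrite ?(ltW sx) ?xt ?sy ?(le_trans (ltW yx) xt).
  have : L * (x - y) <= f.
    have xyf : x - y <= f / (L + 1) by lra.
    apply: (le_trans (ler_wpM2l L0 xyf)).
    by rewrite mulrCA ler_piMr ?(ltW f0)// ler_pdivrMr ?ltr_wpDl// mul1r lerDl.
  have := ler_wpM2l L0 (fmono _ _ (ltW yx)).
  have := ler_wpM2l (ltW e0) (ltW yx).
  move: Dy; rewrite /D !mulrBr; lra.
Qed.

End line.

(** * Motions with two constant accelerations *)

Section relay.
Context {R : realType}.

Lemma lipschitz_within_continuous (f : R -> R) (M a b : R) :
  (forall s t, s \in `[a, b] -> t \in `[a, b] -> `|f s - f t| <= M * `|s - t|) ->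
  {within `[a, b], continuous f}.
Proof.
move=> fM; apply/subspace_continuousP => x /= xab.
apply/cvgrPdist_le => e e0.
have M0 : 0 < `|M| + 1 by rewrite ltr_wpDl.
rewrite near_withinE; near=> t => /= tab.
apply: (le_trans (fM _ _ xab tab)).
apply: (@le_trans _ _ ((`|M| + 1) * `|x - t|)).
  by rewrite ler_wpM2r// (le_trans (ler_norm _))// lerDl.
rewrite mulrC -ler_pdivlMr//.
by near: t; apply: cvgr_dist_le; rewrite // divr_gt0.
Unshelve. all: by end_near. Qed.

Lemma MVT_lipschitz (f df : R -> R) (M a b : R) : a < b ->
  (forall s t, s \in `[a, b] -> t \in `[a, b] -> `|f s - f t| <= M * `|s - t|) ->
  (forall t, t \in `]a, b[ -> is_derive t 1 f (df t)) ->
  exists2 c, c \in `]a, b[ & f b - f a = df c * (b - a).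
Proof. by move=> ab fM fd; apply: MVT => //; exact: lipschitz_within_continuous fM. Qed.

Lemma last_zero (f : R -> R) (M a b : R) : a <= b ->
  (forall s t, s \in `[a, b] -> t \in `[a, b] -> `|f s - f t| <= M * `|s - t|) ->
  f a <= 0 -> 0 < f b ->
  exists c, [/\ a <= c < b, f c = 0 & forall t, c < t <= b -> 0 < f t].
Proof.
move=> ab fM fa fb.
pose E := [set t | a <= t <= b /\ f t <= 0].
have ubE : ubound E b by move=> s [/andP[]].
have hE : has_sup E by split; [exists a; rewrite /E/= lexx ab|exists b].
have cb : sup E <= b by exact: ge_sup hE.1 ubE.
have ac : a <= sup E by apply: ub_le_sup; [exists b|rewrite /E/= lexx ab].
have pos t : sup E < t <= b -> 0 < f t.
  move=> /andP[ct tb]; rewrite ltNge; apply/negP => ft.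
  have : t <= sup E.
    by apply: ub_le_sup; [exists b|rewrite /E/= tb ft (le_trans ac (ltW ct))].
  by rewrite leNgt ct.
have M0 : 0 < `|M| + 1 by rewrite ltr_wpDl.
have fM1 s t : s \in `[a, b] -> t \in `[a, b] ->
    `|f s - f t| <= (`|M| + 1) * `|s - t|.
  move=> sab tab; apply: le_trans (fM _ _ sab tab) _.
  by rewrite ler_wpM2r// (le_trans (ler_norm _))// lerDl.
have fc0 : f (sup E) <= 0.
  apply/ler_addgt0Pr => e e0; rewrite add0r.
  have [|s [/andP[as_ sb] fs] es] := @sup_adherent _ E (e / (`|M| + 1)) _ hE.
    by rewrite divr_gt0.
  have sE : s <= sup E by apply: ub_le_sup; [exists b|rewrite /E/= as_ sb].
  have H := le_trans (ler_norm _) (fM1 (sup E) s _ _).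
  move: H; rewrite !in_itv/= ac cb as_ sb [`|sup E - s|]ger0_norm ?subr_ge0//.
  move=> /(_ isT isT) H.
  have : sup E - s <= e / (`|M| + 1) by lra.
  by rewrite ler_pdivlMr// mulrC; lra.
have cb' : sup E < b.
  by rewrite lt_neqAle cb andbT; apply/eqP => cE; move: fc0; rewrite cE leNgt fb.
exists (sup E); split=> //; first by rewrite ac.
apply/eqP; rewrite eq_le fc0/= leNgt; apply/negP => fcn.
pose t := Num.min b (sup E - f (sup E) / (`|M| + 1)).
have ct : sup E < t.
  by rewrite lt_min cb' -ltrBlDl subrr oppr_gt0 pmulr_llt0// invr_gt0.
have tb : t <= b by rewrite ge_min lexx.
have tt : t <= sup E - f (sup E) / (`|M| + 1) by rewrite ge_min lexx orbT.
have ft : 0 < f t by apply: pos; rewrite ct tb.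
have H := le_trans (ler_norm _) (fM1 t (sup E) _ _).
move: H; rewrite !in_itv/= ac cb tb (le_trans ac (ltW ct)).
rewrite [`|t - sup E|]ger0_norm ?subr_ge0 ?(ltW ct)// => /(_ isT isT) H.
have : t - sup E <= - f (sup E) / (`|M| + 1) by lra.
by rewrite ler_pdivlMr// mulrC; lra.
Qed.

(** A motion [u] with velocity [du], acceleration [yp] on [u > 0] and [yn] on
    [u < 0], and only a Lipschitz velocity on [u = 0].  The acceleration is
    given in integrated form, on closed intervals, which avoids exceptional
    times and is manifestly invariant under time reversal. *)
Record relay (l r L M yn yp : R) (u du : R -> R) : Prop := Relay {
  relay_L : 0 <= L;
  relay_lip : forall s t, s \in `[l, r] -> t \in `[l, r] ->
    `|u s - u t| <= M * `|s - t|;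
  relay_der : forall t, t \in `]l, r[ -> is_derive t 1 u (du t);
  relay_dlip : forall s t, s \in `]l, r[ -> t \in `]l, r[ ->
    `|du s - du t| <= L * `|s - t|;
  relay_pos : forall c d, l < c -> d < r ->
    (forall t, t \in `]c, d[ -> 0 < u t) ->
    forall s t, s \in `[c, d] -> t \in `[c, d] -> du t - du s = yp * (t - s);
  relay_neg : forall c d, l < c -> d < r ->
    (forall t, t \in `]c, d[ -> u t < 0) ->
    forall s t, s \in `[c, d] -> t \in `[c, d] -> du t - du s = yn * (t - s) }.

Lemma relay_opp l r L M yn yp u du : relay l r L M yn yp u du ->
  relay l r L M (- yp) (- yn) (fun t => - u t) (fun t => - du t).
Proof.
move=> [L0 uM ud duL up un]; split=> //.
- by move=> s t sI tI; rewrite -opprD normrN uM.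
- by move=> t tI; have := ud _ tI => ?; apply: is_deriveN.
- by move=> s t sI tI; rewrite -opprD normrN duL.
- move=> c d lc dr H s t sI tI.
  rewrite mulNr -(un c d lc dr _ s t sI tI); first lra.
  by move=> z /H; rewrite oppr_gt0.
- move=> c d lc dr H s t sI tI.
  rewrite mulNr -(up c d lc dr _ s t sI tI); first lra.
  by move=> z /H; rewrite oppr_lt0.
Qed.

Lemma relay_rev l r L M yn yp u du : relay l r L M yn yp u du ->
  relay (- r) (- l) L M yn yp (fun t => u (- t)) (fun t => - du (- t)).
Proof.
have I1 (a b t : R) : (t \in `]- b, - a[) = (- t \in `]a, b[).
  by rewrite !in_itv/= andbC ltrNr ltrNl.
have I2 (a b t : R) : (t \in `[- b, - a]) = (- t \in `[a, b]).
  by rewrite !in_itv/= andbC lerNr lerNl.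
have I3 (a b t : R) : (t \in `]a, b[) = (- t \in `]- b, - a[) by rewrite I1 opprK.
have I4 (a b t : R) : (t \in `[a, b]) = (- t \in `[- b, - a]) by rewrite I2 opprK.
have N (s t : R) : `|- s - - t| = `|s - t| by rewrite -opprD normrN.
move=> [L0 uM ud duL up un]; split=> //.
- by move=> s t; rewrite !I2 => sI tI; rewrite -[X in _ <= _ * X]N uM.
- move=> t; rewrite I1 => /ud ?.
  have ? : is_derive t 1 (fun t : R => - t) (-1 : R) by apply: is_deriveN.
  rewrite -[X in is_derive _ _ _ X]mulrN1.
  exact: (@is_derive1_comp _ u (fun t : R => - t)).
- by move=> s t; rewrite !I1 => sI tI; rewrite N distrC -[X in _ <= _ * X]N distrC duL.
- move=> c d lc dr H s t; rewrite (I4 c) (I4 c _ t) => sI tI.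
  have H' z : z \in `]- d, - c[ -> 0 < u z by rewrite I1 => /H; rewrite opprK.
  have := up (- d) (- c) _ _ H' (- s) (- t) sI tI.
  by rewrite ltrNr dr ltrNl lc => /(_ isT isT); lra.
- move=> c d lc dr H s t; rewrite (I4 c) (I4 c _ t) => sI tI.
  have H' z : z \in `]- d, - c[ -> u z < 0 by rewrite I1 => /H; rewrite opprK.
  have := un (- d) (- c) _ _ H' (- s) (- t) sI tI.
  by rewrite ltrNr dr ltrNl lc => /(_ isT isT); lra.
Qed.

End relay.

(** * Energy and the absence of chattering *)

Section energy.
Context {R : realType}.

(** Kinetic plus potential energy: the subtracted term is the primitive of the
    force that vanishes at 0. *)
Definition energy (yn yp u du : R) : R :=
  du ^+ 2 / 2 - (if 0 <= u then yp * u else yn * u).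

Lemma energy_opp (yn yp u du : R) : energy (- yp) (- yn) (- u) (- du) = energy yn yp u du.
Proof.
rewrite /energy sqrrN oppr_ge0; congr (_ - _).
by have [u0|u0|<-] := ltgtP 0 u; rewrite ?mulrNN ?oppr0 ?mulr0.
Qed.

Lemma energyN (yn yp u du : R) : energy yn yp u (- du) = energy yn yp u du.
Proof. by rewrite /energy sqrrN. Qed.

Lemma relay_parabola (l r L M yn yp c d : R) u du : relay l r L M yn yp u du ->
  l < c -> d < r -> (forall t, t \in `]c, d[ -> 0 < u t) ->
  forall t, t \in `[c, d] ->
    du t = du c + yp * (t - c) /\
    u t = u c + du c * (t - c) + yp * (t - c) ^+ 2 / 2.
Proof.
move=> rel lc dr pos t tI.
have cI : c \in `[c, d].
  by move: tI; rewrite !in_itv/= => /andP[ct td]; rewrite lexx (le_trans ct td).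
have duE s : s \in `[c, d] -> du s = du c + yp * (s - c).
  by move=> sI; rewrite -(relay_pos rel lc dr pos cI sI); lra.
split; first exact: duE.
move: (tI); rewrite in_itv/= => /andP[ct td].
pose F : R -> R := fun s : R => u s - (du c * (s - c) + yp / 2 * (s - c) ^+ 2).
have subI s : s \in `[c, t] -> (s \in `]l, r[) /\ (s \in `[c, d]).
  rewrite !in_itv/= => /andP[cs st]; rewrite cs (le_trans st td).
  by rewrite (lt_le_trans lc cs) (le_lt_trans st (le_lt_trans td dr)).
have dF s : s \in `[c, t] -> is_derive s 1 F 0.
  move=> sI; have [slr scd] := subI _ sI.
  have ? := relay_der rel slr.
  rewrite /F; apply: is_derive_eq; rewrite (duE _ scd).
  rewrite /GRing.scale/=; lra.
have cF : {within `[c, t], continuous F}.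
  by apply: derivable_within_continuous => s /dF[].
have dF' x : x \in `]c, t[ -> is_derive x 1 F ((fun=> 0 : R) x).
  by move=> xI; apply: dF; apply: subset_itv_oo_cc.
have MV := @MVT_segment _ F (fun=> 0) c t ct dF'.
have [s _] := MV cF.
rewrite mul0r /F subrr expr0n/= !mulr0 addr0; lra.
Qed.

Lemma energy_pos (l r L M yn yp c d : R) u du : relay l r L M yn yp u du ->
  l < c -> c < d -> d < r -> (forall t, t \in `]c, d[ -> 0 < u t) -> 0 <= u c ->
  forall t, t \in `[c, d[ ->
  energy yn yp (u t) (du t) = energy yn yp (u c) (du c).
Proof.
move=> rel lc cd dr pos uc t; rewrite in_itv/= => /andP[ct td].
have [->//|tc] := eqVneq t c.
have ut : 0 < u t by apply: pos; rewrite in_itv/= lt_neqAle eq_sym tc ct.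
have tcd : t \in `[c, d] by rewrite in_itv/= ct ltW.
have [duE uE] := relay_parabola rel lc dr pos tcd.
rewrite /energy uc (ltW ut) duE uE; by field.
Qed.

Lemma relay_near_pos (l r L M yn yp t : R) u du : relay l r L M yn yp u du ->
  t \in `]l, r[ -> 0 < u t ->
  exists2 d, t < d < r & forall s, s \in `]t, d[ -> 0 < u s.
Proof.
move=> rel; rewrite in_itv/= => /andP[lt tr] ut.
have M0 : 0 < `|M| + 1 by rewrite ltr_wpDl.
pose d := Num.min ((t + r) / 2) (t + u t / (`|M| + 1)).
have td : t < d by rewrite lt_min ltrDl divr_gt0// andbT; lra.
have d1 : d <= (t + r) / 2 by rewrite ge_min lexx.
have d2 : d <= t + u t / (`|M| + 1) by rewrite ge_min lexx orbT.
exists d; first by rewrite td; lra.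
move=> s; rewrite in_itv/= => /andP[ts sd].
have sI : s \in `[l, r] by rewrite in_itv/=; apply/andP; split; lra.
have tI : t \in `[l, r] by rewrite in_itv/=; apply/andP; split; lra.
have := le_trans (ler_norm _) (relay_lip rel tI sI).
rewrite distrC gtr0_norm ?subr_gt0//.
have : (`|M| + 1) * (s - t) < u t.
  by rewrite mulrC -ltr_pdivlMr//; lra.
have : M * (s - t) <= (`|M|) * (s - t) by rewrite ler_wpM2r ?ler_norm// subr_ge0 ltW.
lra.
Qed.

Lemma relay_near_pos0 (l r L M yn yp t : R) u du : relay l r L M yn yp u du ->
  t \in `]l, r[ -> u t = 0 -> 0 < du t ->
  exists2 d, t < d < r & forall s, s \in `]t, d[ -> 0 < u s.
Proof.
move=> rel tlr ut dut; move: (tlr); rewrite in_itv/= => /andP[lt tr].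
have L0 := relay_L rel.
have L1 : 0 < L + 1 by rewrite ltr_wpDl.
pose d := Num.min ((t + r) / 2) (t + du t / (L + 1)).
have td : t < d by rewrite lt_min ltrDl divr_gt0// andbT; lra.
have d1 : d <= (t + r) / 2 by rewrite ge_min lexx.
have d2 : d <= t + du t / (L + 1) by rewrite ge_min lexx orbT.
exists d; first by rewrite td; lra.
move=> s; rewrite in_itv/= => /andP[ts sd].
have inlr x : t <= x <= s -> x \in `]l, r[.
  by move=> /andP[tx xs]; rewrite in_itv/=; apply/andP; split; lra.
have [|||x xts] := @MVT_lipschitz _ u du M t s.
- by [].
- move=> x y; rewrite !in_itv/= => /andP[? ?] /andP[? ?].
  by apply: (relay_lip rel); rewrite in_itv/=; apply/andP; split; lra.
- move=> x; rewrite in_itv/= => /andP[? ?]; apply: (relay_der rel).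
  by apply: inlr; apply/andP; split; lra.
rewrite ut subr0 => ->; rewrite mulr_gt0 ?subr_gt0//.
move: xts; rewrite in_itv/= => /andP[tx xs].
have xlr : x \in `]l, r[ by apply: inlr; apply/andP; split; lra.
have := le_trans (ler_norm _) (relay_dlip rel tlr xlr).
rewrite distrC gtr0_norm ?subr_gt0//.
have : (L + 1) * (x - t) < du t by rewrite mulrC -ltr_pdivlMr//; lra.
lra.
Qed.

(** After a time of rest at 0 the position is of second order, so that the
    energy cannot change at first order there. *)
Lemma relay_rest (l r L M yn yp t s : R) u du : relay l r L M yn yp u du ->
  t \in `]l, r[ -> s \in `]l, r[ -> t < s -> u t = 0 -> du t = 0 ->
  `|du s| <= L * (s - t) /\ `|u s| <= L * (s - t) ^+ 2.
Proof.
move=> rel tlr slr ts ut dut.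
have bd x : x \in `[t, s] -> `|du x| <= L * (x - t).
  move=> xI; have xlr : x \in `]l, r[.
    move: xI tlr slr; rewrite !in_itv/= => /andP[? ?] /andP[? ?] /andP[? ?].
    by apply/andP; split; lra.
  have := relay_dlip rel xlr tlr; rewrite dut subr0 [`|x - t|]ger0_norm//.
  by move: xI; rewrite in_itv/= subr_ge0 => /andP[].
split; first by apply: bd; rewrite in_itv/= lexx ltW.
move: (tlr) (slr); rewrite !in_itv/= => /andP[? ?] /andP[? ?].
have [|||x] := @MVT_lipschitz _ u du M t s.
- by [].
- move=> x y; rewrite !in_itv/= => /andP[? ?] /andP[? ?].
  by apply: (relay_lip rel); rewrite in_itv/=; apply/andP; split; lra.
- move=> x; rewrite in_itv/= => /andP[? ?]; apply: (relay_der rel).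
  by rewrite in_itv/=; apply/andP; split; lra.
rewrite in_itv/= => /andP[tx xs].
rewrite ut subr0 => ->; rewrite normrM [`|s - t|]gtr0_norm ?subr_gt0// expr2 mulrA.
rewrite ler_wpM2r ?subr_ge0 ?(ltW ts)//.
apply: (le_trans (bd x _)); first by rewrite in_itv/= !ltW.
by rewrite ler_wpM2l ?(relay_L rel)//; lra.
Qed.

Lemma energy_bound (yn yp u du : R) :
  `|energy yn yp u du| <= du ^+ 2 + (`|yn| + `|yp|) * `|u|.
Proof.
rewrite /energy (le_trans (ler_normB _ _))// lerD//.
  by rewrite ger0_norm ?divr_ge0 ?sqr_ge0//; have := sqr_ge0 du; lra.
by case: ifP => _; rewrite normrM ler_wpM2r// ?lerDl// lerDr.
Qed.

(** Just after [t] either [u] has a constant sign, and the energy is constant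
    along a parabola, or [u t = du t = 0] and the energy is of second order
    by [relay_rest].  Crossings of 0 with nonzero velocity fall in the first
    case. *)
Lemma energy_flat_right (l r L M yn yp t e : R) u du : relay l r L M yn yp u du ->
  t \in `]l, r[ -> 0 < e ->
  exists2 d, t < d < r & forall s, t < s < d ->
    `|energy yn yp (u s) (du s) - energy yn yp (u t) (du t)| <= e * (s - t).
Proof.
move=> rel tlr e0; move: (tlr); rewrite in_itv/= => /andP[lt tr].
have constP yn' yp' u' du' : relay l r L M yn' yp' u' du' -> 0 <= u' t ->
    (exists2 d, t < d < r & forall s, s \in `]t, d[ -> 0 < u' s) ->
    exists2 d, t < d < r & forall s, t < s < d ->
    `|energy yn' yp' (u' s) (du' s) - energy yn' yp' (u' t) (du' t)| <= e * (s - t).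
  move=> rel' ut [d /andP[td dr] pos]; exists d; first by rewrite td.
  move=> s /andP[ts sd]; rewrite (energy_pos rel' lt td dr pos ut).
    by rewrite subrr normr0 mulr_ge0 ?(ltW e0)// subr_ge0 ltW.
  by rewrite in_itv/= ltW.
have relN := relay_opp rel.
have constN : u t <= 0 ->
    (exists2 d, t < d < r & forall s, s \in `]t, d[ -> 0 < - u s) ->
    exists2 d, t < d < r & forall s, t < s < d ->
    `|energy yn yp (u s) (du s) - energy yn yp (u t) (du t)| <= e * (s - t).
  rewrite -oppr_ge0 => ut /(constP _ _ _ _ relN ut)[d td H]; exists d => // s /H.
  by rewrite !energy_opp.
have [ut|ut|ut] := ltgtP 0 (u t).
- by apply: (constP _ _ _ _ rel (ltW ut)); exact: relay_near_pos rel tlr ut.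
- apply: (constN (ltW ut)); apply: (relay_near_pos relN tlr).
  by rewrite oppr_gt0.
have [dut|dut|dut] := ltgtP 0 (du t).
- apply: (constP _ _ _ _ rel); first by rewrite -ut.
  by apply: relay_near_pos0 rel tlr _ dut.
- apply: constN; first by rewrite -ut.
  by apply: (relay_near_pos0 relN tlr); rewrite ?oppr_gt0// -ut oppr0.
(* at rest at 0, the energy is bounded by [K * (s - t) ^+ 2] *)
pose K := L ^+ 2 + (`|yn| + `|yp|) * L + 1.
have L0 := relay_L rel.
have K0 : 0 < K.
  by rewrite /K ltr_wpDl// addr_ge0 ?sqr_ge0// mulr_ge0// addr_ge0.
pose d := Num.min ((t + r) / 2) (t + e / K).
have td : t < d by rewrite lt_min ltrDl divr_gt0// andbT; lra.
have d1 : d <= (t + r) / 2 by rewrite ge_min lexx.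
have d2 : d <= t + e / K by rewrite ge_min lexx orbT.
exists d; first by rewrite td; lra.
move=> s /andP[ts sd].
have slr : s \in `]l, r[ by rewrite in_itv/=; apply/andP; split; lra.
have [dus us] := relay_rest rel tlr slr ts (esym ut) (esym dut).
rewrite -ut -dut {2}/energy lexx mulr0 expr0n/= mul0r !subr0.
apply: (le_trans (energy_bound _ _ _ _)).
have : du s ^+ 2 <= L ^+ 2 * (s - t) ^+ 2.
  by rewrite -exprMn -real_normK ?num_real// ler_sqr ?nnegrE// mulr_ge0// subr_ge0 ltW.
have : (`|yn| + `|yp|) * `|u s| <= (`|yn| + `|yp|) * (L * (s - t) ^+ 2).
  by rewrite ler_wpM2l ?addr_ge0.
have : K * (s - t) ^+ 2 <= e * (s - t).
  rewrite expr2 mulrA ler_wpM2r ?subr_ge0 ?(ltW ts)// mulrC -ler_pdivlMr//; lra.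
have := sqr_ge0 (s - t).
rewrite /K; lra.
Qed.

Lemma energy_flat (l r L M yn yp t e : R) u du : relay l r L M yn yp u du ->
  t \in `]l, r[ -> 0 < e ->
  exists2 d, 0 < d & forall s, `|s - t| < d ->
    `|energy yn yp (u s) (du s) - energy yn yp (u t) (du t)| <= e * `|s - t|.
Proof.
move=> rel tlr e0; move: (tlr); rewrite in_itv/= => /andP[lt tr].
have [d /andP[td dr] H] := energy_flat_right rel tlr e0.
have [|d' /andP[td' dr'] H'] := @energy_flat_right _ _ _ _ _ _ (- t) _ _ _ (relay_rev rel) _ e0.
  by rewrite in_itv/= !ltrN2 tr lt.
exists (Num.min (d - t) (d' + t)).
  by rewrite lt_min subr_gt0 td/=; lra.
move=> s; rewrite lt_min => /andP[h1 h2].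
have [ts|st|->] := ltgtP t s; last by rewrite !subrr normr0 mulr0.
- have ts0 : 0 < s - t by rewrite subr_gt0.
  by move: h1; rewrite gtr0_norm// => h1; apply: H; rewrite ts; lra.
- have ts0 : s - t < 0 by rewrite subr_lt0.
  move: h2; rewrite ltr0_norm// => h2; have := H' (- s).
  rewrite !opprK !energyN [- (s - t)](_ : _ = - s + t); last ring.
  by apply; rewrite ltrN2 st; lra.
Qed.

Lemma energy_cst (l r L M yn yp : R) u du : relay l r L M yn yp u du ->
  forall s t, s \in `]l, r[ -> t \in `]l, r[ ->
  energy yn yp (u s) (du s) = energy yn yp (u t) (du t).
Proof.
move=> rel s t.
pose g x := energy yn yp (u x) (du x).
have flat x e : x \in `]l, r[ -> 0 < e -> exists2 d, 0 < d & forall y, `|y - x| < d ->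
    `|g y - g x| <= e * `|y - x| by move=> xI e0; exact: energy_flat rel xI e0.
rewrite -/(g s) -/(g t).
wlog st : s t / s <= t.
  by move=> wl sI tI; have [/wl|/ltW/wl H] := leP s t; [apply|rewrite H].
move=> sI tI.
have inst x : s <= x <= t -> x \in `]l, r[.
  move: sI tI; rewrite !in_itv/= => /andP[? ?] /andP[? ?] /andP[? ?].
  by apply/andP; split; lra.
suff H e : 0 < e -> `|g t - g s| <= e * (t - s + 1).
  apply/esym/eqP; rewrite -subr_eq0 -normr_eq0 eq_le normr_ge0 andbT.
  apply/ler_addgt0Pr => e e0; rewrite add0r.
  have ts0 : 0 < t - s + 1 by lra.
  by have := H (e / (t - s + 1)); rewrite divr_gt0// divfK ?gt_eqF//; apply.
move=> e0.
suff : `|g t - g s| <= e * (t - s) by lra.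
apply: (@real_induction _ (fun x => `|g x - g s| <= e * (x - s)) s t) => //.
- by rewrite !subrr normr0 mulr0.
- move=> x /andP[sx xt] Dx.
  have xI : x \in `]l, r[ by apply: inst; rewrite sx ltW.
  have [d d0 H] := flat x e xI e0.
  pose y := Num.min (x + d / 2) t.
  have xy : x < y by rewrite lt_min xt andbT ltrDl divr_gt0.
  have yt : y <= t by rewrite ge_min lexx orbT.
  have yr : y <= x + d / 2 by rewrite ge_min lexx.
  exists y; first by rewrite xy.
  have := H y; rewrite gtr0_norm ?subr_gt0// => {}H.
  have -> : g y - g s = (g y - g x) + (g x - g s) by ring.
  have {}H : `|g y - g x| <= e * (y - x) by apply: H; lra.
  by rewrite (le_trans (ler_normD _ _))//; lra.
- move=> x /andP[sx xt] Dapp.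
  have xI : x \in `]l, r[ by apply: inst; rewrite xt ltW.
  have [d d0 H] := flat x e xI e0.
  have [y [sy dy yx Dy]] := Dapp _ d0.
  have := H y; rewrite ltr0_norm ?subr_lt0// => {}H.
  have -> : g x - g s = - (g y - g x) + (g y - g s) by ring.
  have {}H : `|g y - g x| <= e * - (y - x) by apply: H; lra.
  by rewrite (le_trans (ler_normD _ _))// normrN; lra.
Qed.

(** At zero energy [du ^+ 2 = 2 * yp * u] on [u > 0].  If [u] came back to 0, an
    interior maximum would give [yp = 0], hence a null velocity on [u > 0], and
    [u] could not have risen from its last zero. *)
Lemma relay_no_return (l r L M yn yp s t : R) u du : relay l r L M yn yp u du ->
  u l = 0 -> (forall x, x \in `]l, r[ -> energy yn yp (u x) (du x) = 0) ->
  l < s -> s < t -> t < r -> 0 < u s -> 0 < u t.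
Proof.
move=> rel ul en ls st tr us; rewrite ltNge; apply/negP => ut.
have lip a b : l <= a -> b <= r ->
    forall x y, x \in `[a, b] -> y \in `[a, b] -> `|u x - u y| <= M * `|x - y|.
  move=> la br x y; rewrite !in_itv/= => /andP[? ?] /andP[? ?].
  by apply: (relay_lip rel); rewrite in_itv/=; apply/andP; split; lra.
have lt : l < t by lra.
have [x xI xmax] := EVT_max (ltW lt) (lipschitz_within_continuous (lip _ _ (lexx l) (ltW tr))).
have ux : 0 < u x.
  by apply: (lt_le_trans us); apply: xmax; rewrite in_itv/= !ltW.
have /andP[lx xt] : l < x < t.
  move: xI; rewrite in_itv/= !lt_neqAle => /andP[-> ->]; rewrite !andbT.
  apply/andP; split; apply/eqP => xE; move: ux.
    by rewrite -xE ul ltxx.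
  by rewrite xE ltNge ut.
have xlr : x \in `]l, r[ by rewrite in_itv/= lx; lra.
have dux : du x = 0.
  have D0 : is_derive x 1 u 0.
    apply: (derive1_at_max (ltW lt)).
    - move=> z; rewrite in_itv/= => /andP[lz zt].
      by have [] : is_derive z 1 u (du z) by apply: (relay_der rel); rewrite in_itv/= lz; lra.
    - by rewrite in_itv/= lx.
    - by move=> z zI; apply: xmax; apply: subset_itv_oo_cc.
  have D1 := relay_der rel xlr.
  by rewrite -(@derive_val _ _ _ _ _ _ _ D1) (@derive_val _ _ _ _ _ _ _ D0).
have yp0 : yp = 0.
  have := en _ xlr; rewrite /energy (ltW ux) dux expr0n mul0r sub0r => /eqP.
  by rewrite oppr_eq0 mulf_eq0 (gt_eqF ux) orbF => /eqP.
have lipx := lip l x (lexx l) (ltW (lt_trans xt tr)).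
have [|c [/andP[lc cx] uc pos]] := last_zero (ltW lx) lipx _ ux; first by rewrite ul.
have [||z zI] := @MVT_lipschitz _ u du M c x cx.
- by apply: lip => //; lra.
- move=> z; rewrite in_itv/= => /andP[cz zx].
  by apply: (relay_der rel); rewrite in_itv/=; apply/andP; split; lra.
move: zI; rewrite in_itv/= => /andP[cz zx].
have uz : 0 < u z by apply: pos; rewrite cz ltW.
have := en z; rewrite in_itv/= (le_lt_trans lc cz) (lt_trans zx (lt_trans xt tr)).
rewrite /energy (ltW uz) yp0 mul0r subr0 => /(_ isT)/eqP.
rewrite mulf_eq0 invr_eq0 pnatr_eq0 orbF expf_eq0/= => /eqP ->.
by rewrite mul0r uc subr0; lra.
Qed.

(** Either [`|du t1| > L * (t1 - l)] for some [t1], and then the Lipschitz bound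
    keeps the sign of [du] between [l] and [t1]; or [du] tends to 0 at [l], the
    energy is zero, and [relay_no_return] applies. *)
Lemma relay_trichotomy (l r L M yn yp : R) u du : relay l r L M yn yp u du ->
  l < r -> u l = 0 ->
  exists2 d, l < d <= r &
    [\/ forall t, t \in `]l, d[ -> u t = 0, forall t, t \in `]l, d[ -> 0 < u t
      | forall t, t \in `]l, d[ -> u t < 0].
Proof.
move=> rel lr ul.
have [[t1 t1I Ht1]|Hn] := pselect (exists2 t, t \in `]l, r[ & L * (t - l) < `|du t|).
  have fast yn' yp' u' du' : relay l r L M yn' yp' u' du' -> u' l = 0 ->
      L * (t1 - l) < du' t1 -> forall t, t \in `]l, t1[ -> 0 < u' t.
    move=> rel' ul' Ht1' t; rewrite in_itv/= => /andP[lt tt1].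
    move: (t1I); rewrite in_itv/= => /andP[? ?].
    have [||z zI] := @MVT_lipschitz _ u' du' M l t lt.
    - move=> x y; rewrite !in_itv/= => /andP[? ?] /andP[? ?].
      by apply: (relay_lip rel'); rewrite in_itv/=; apply/andP; split; lra.
    - move=> z; rewrite in_itv/= => /andP[? ?].
      by apply: (relay_der rel'); rewrite in_itv/=; apply/andP; split; lra.
    rewrite ul' subr0 => ->; rewrite mulr_gt0 ?subr_gt0//.
    move: zI; rewrite in_itv/= => /andP[lz zt].
    have zlr : z \in `]l, r[ by rewrite in_itv/=; apply/andP; split; lra.
    have := le_trans (ler_norm _) (relay_dlip rel' t1I zlr).
    rewrite gtr0_norm; last lra.
    have : L * (t1 - z) <= L * (t1 - l) by rewrite ler_wpM2l ?(relay_L rel)//; lra.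
    lra.
  exists t1; first by move: t1I; rewrite in_itv/= => /andP[-> /ltW].
  have [du0|du0] := leP 0 (du t1).
    apply: Or32; apply: (fast _ _ _ _ rel ul).
    by move: Ht1; rewrite ger0_norm.
  apply: Or33 => t tI; rewrite -oppr_gt0.
  apply: (fast _ _ _ _ (relay_opp rel)) => //; first by rewrite ul oppr0.
  by move: Ht1; rewrite ltr0_norm.
have slow t : t \in `]l, r[ -> `|du t| <= L * (t - l).
  by move=> tI; rewrite leNgt; apply/negP => H; apply: Hn; exists t.
have L0 := relay_L rel.
have en t : t \in `]l, r[ -> energy yn yp (u t) (du t) = 0.
  move=> tI; apply/eqP; rewrite -normr_eq0 eq_le normr_ge0 andbT.
  apply/ler_addgt0Pr => e e0; rewrite add0r.
  (* the constant value of the energy is at most [K * (s - l)] for every [s] *)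
  pose K := L ^+ 2 * (r - l) + (`|yn| + `|yp|) * `|M| + 1.
  have K0 : 0 < K.
    have A1 : 0 <= L ^+ 2 * (r - l) by rewrite mulr_ge0 ?sqr_ge0//; lra.
    have A2 : 0 <= (`|yn| + `|yp|) * `|M| by rewrite mulr_ge0 ?addr_ge0.
    by rewrite /K; lra.
  pose s := Num.min ((l + r) / 2) (l + e / K).
  have ls : l < s by rewrite lt_min ltrDl divr_gt0// andbT; lra.
  have s1 : s <= (l + r) / 2 by rewrite ge_min lexx.
  have s2 : s <= l + e / K by rewrite ge_min lexx orbT.
  have sI : s \in `]l, r[ by rewrite in_itv/= ls; lra.
  rewrite (energy_cst rel tI sI) (le_trans (energy_bound _ _ _ _))//.
  have H0 : K * (s - l) <= e by rewrite mulrC -ler_pdivlMr//; lra.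
  apply: le_trans H0.
  have : du s ^+ 2 <= L ^+ 2 * (r - l) * (s - l).
    have : du s ^+ 2 <= L ^+ 2 * (s - l) ^+ 2.
      rewrite -exprMn -real_normK ?num_real// ler_sqr ?nnegrE//; last first.
        by rewrite mulr_ge0//; lra.
      exact: slow.
    move=> H; apply: (le_trans H); rewrite -mulrA ler_wpM2l ?sqr_ge0// expr2.
    by rewrite ler_wpM2r//; lra.
  have : (`|yn| + `|yp|) * `|u s| <= (`|yn| + `|yp|) * (`|M| * (s - l)).
    rewrite ler_wpM2l ?addr_ge0//.
    have := @relay_lip _ _ _ _ _ _ _ _ _ rel s l.
    rewrite ul subr0 [`|s - l|]gtr0_norm ?subr_gt0// => H.
    apply: (le_trans (H _ _)); rewrite ?in_itv/= ?lexx ?(ltW lr)//.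
    - by rewrite ltW//; lra.
    - by rewrite ler_wpM2r ?ler_norm//; lra.
  rewrite /K; lra.
have [[d ldr H]|H] := pselect (exists2 d, l < d <= r & forall t, t \in `]l, d[ -> u t = 0).
  by exists d => //; apply: Or31.
have nz d : l < d <= r -> exists t, [/\ l < t, t < d & u t != 0].
  move=> ld; apply/not_existsP => Hd; apply: H; exists d => // t.
  rewrite in_itv/= => /andP[lt td]; apply/eqP; apply: contra_notT (Hd t) => ut.
  by split.
have [s [ls sr us]] := nz r (introT andP (conj lr (lexx r))).
exists s; first by rewrite ls ltW.
have keep yn' yp' u' du' : relay l r L M yn' yp' u' du' -> u' l = 0 ->
    (forall t, t \in `]l, r[ -> energy yn' yp' (u' t) (du' t) = 0) ->
    (forall t, (u' t != 0) = (u t != 0)) ->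
    0 < u' s -> forall t, t \in `]l, s[ -> 0 < u' t.
  move=> rel' ul' en' nz' us' t; rewrite in_itv/= => /andP[lt ts].
  have [|z [lz zt]] := nz t; first by rewrite lt; lra.
  rewrite -nz' neq_lt => /orP[uz|uz]; last first.
    by apply: (relay_no_return rel' ul' en' lz zt _ uz); lra.
  have : 0 < - u' s.
    apply: (relay_no_return (relay_opp rel') _ _ lz (lt_trans zt ts) sr).
    - by rewrite ul' oppr0.
    - by move=> x /en'; rewrite energy_opp.
    - by rewrite oppr_gt0.
  by rewrite oppr_gt0 ltNge (ltW us').
move: us; rewrite neq_lt => /orP[us|us]; last first.
  by apply: Or32; apply: keep rel _ _ _ us.
apply: Or33 => t tI; rewrite -oppr_gt0.
apply: (keep _ _ _ _ (relay_opp rel)) => //.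
- by rewrite ul oppr0.
- by move=> x /en; rewrite energy_opp.
- by move=> x; rewrite oppr_eq0.
- by rewrite oppr_gt0.
Qed.

End energy.

(** * Area in the plane *)

Section area.
Context {R : realType}.
Local Notation mR := (measurableTypeR R).
Local Notation leb := (@lebesgue_measure R).
Implicit Types (A B : set (R * R)).

Definition plane_measure : {measure set (mR * mR) -> \bar R} :=
  (leb \x leb)%E.

(** Borel sets of the plane, for the sigma-algebra on which the product of two
    Lebesgue measures is defined. *)
Definition plane_measurable A : Prop := @measurable _ (mR * mR)%type A.

Lemma area2E A : area2 A = plane_measure A.
Proof. by []. Qed.

Lemma plane_measurable_le (f g : R * R -> R) :
  @measurable_fun _ _ (mR * mR)%type R setT f ->
  @measurable_fun _ _ (mR * mR)%type R setT g -> plane_measurable [set p | f p <= g p].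
Proof.
move=> mf mg; rewrite -[X in plane_measurable X]setTI.
exact: (measurable_fun_ler mf mg measurableT (Y := [set true])).
Qed.

Lemma plane_measurable_fst : @measurable_fun _ _ (mR * mR)%type R setT fst.
Proof. exact: measurable_fst. Qed.
Lemma plane_measurable_snd : @measurable_fun _ _ (mR * mR)%type R setT snd.
Proof. exact: measurable_snd. Qed.

Lemma plane_measurable_linear (a b : R) :
  @measurable_fun _ _ (mR * mR)%type R setT (fun p => a * p.1 + b * p.2).
Proof.
by apply: measurable_funD; apply: measurable_funM.
Qed.

Definition radius (p : R * R) : R := Num.sqrt (p.1 ^+ 2 + p.2 ^+ 2).

Lemma plane_measurable_radius : @measurable_fun _ _ (mR * mR)%type R setT radius.
Proof.
apply: (@measurableT_comp _ _ _ _ _ _ (@Num.sqrt R)).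
  exact: continuous_measurable_fun (@sqrt_continuous R).
apply: measurable_funD; apply: measurable_funX.
  exact: plane_measurable_fst.
exact: plane_measurable_snd.
Qed.

Definition box (rho : R) : set (R * R) := `[- rho, rho] `*` `[- rho, rho].

Lemma plane_measurable_box rho : plane_measurable (box rho).
Proof. apply: (@measurableX _ _ mR mR); exact: measurable_itv. Qed.

Lemma lebesgue_itvcc (a b : R) : a <= b -> leb `[a, b]%classic = (b - a)%:E.
Proof.
move=> ab; have := lebesgue_measure_itv `[a, b]; rewrite /= lte_fin => H.
apply: (eq_trans H); case: ifPn => [_|]; first by rewrite -EFinB.
by rewrite -leNgt => ?; congr _%:E; lra.
Qed.

Lemma area2_box rho : 0 <= rho -> area2 (box rho) = (2 * rho * (2 * rho))%:E.
Proof.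
move=> r0; rewrite /area2 /box product_measure1E; try exact: measurable_itv.
rewrite EFinM; have -> : 2 * rho = rho - - rho by ring.
by congr (_ * _)%E; apply: lebesgue_itvcc; lra.
Qed.

Lemma area2_le A B : plane_measurable A -> plane_measurable B -> A `<=` B -> (area2 A <= area2 B)%E.
Proof. by move=> mA mB AB; rewrite !area2E le_measure ?inE. Qed.

Lemma area2U_le A B : plane_measurable A -> plane_measurable B ->
  (area2 (A `|` B) <= area2 A + area2 B)%E.
Proof. by move=> mA mB; rewrite !area2E measureU2. Qed.

Lemma area2_swapE A : plane_measurable A -> area2 A = (leb \x^ leb)%E A.
Proof.
move=> mA; rewrite /area2; apply: product_measure_unique => // B C mB mC.
exact: product_measure2E.
Qed.

Lemma integral_le_box (rho k : R) (f : mR -> \bar R) : 0 <= rho ->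
  measurable_fun setT f -> (forall x, (0 <= f x)%E) ->
  (forall x, (f x <= k%:E)%E) ->
  (forall x : R, ~~ (x \in `[- rho, rho]) -> f x = 0%E) ->
  (\int[leb]_x f x <= (2 * rho * k)%:E)%E.
Proof.
move=> r0 mf f0 fk fout.
have k0 : 0 <= k by rewrite -lee_fin (le_trans (f0 0)).
pose I := (`[- rho, rho]%classic : set mR).
have mI : measurable I by exact: measurable_itv.
have -> : (2 * rho * k)%:E = (\int[leb]_x (k%:E * (\1_I x)%:E))%E.
  rewrite ge0_integralZl_EFin//; last exact: measurableT_comp.
  rewrite integral_indic// setIT EFinM muleC; congr (_ * _)%E; apply/esym.
  by apply: (eq_trans (lebesgue_itvcc _)); [lra|congr _%:E; ring].
apply: ge0_le_integral => //.
  apply: measurable_funeM; exact: measurableT_comp.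
move=> x _; rewrite indicE; have [xI|xI] := boolP (x \in I).
  by rewrite mule1.
by rewrite mule0 fout//; apply: contra xI => xI; rewrite inE.
Qed.

Lemma area2_xsection (rho k : R) A : plane_measurable A -> 0 <= rho ->
  (forall p, A p -> `|p.1| <= rho) ->
  (forall x, exists a b, [/\ a <= b, b - a <= k & forall y, A (x, y) -> a <= y <= b]) ->
  (area2 A <= (2 * rho * k)%:E)%E.
Proof.
move=> mA r0 Arho Ak; apply: integral_le_box => //.
- exact: measurable_fun_xsection.
- move=> x /=; have [a [b [ab bak H]]] := Ak x.
  have : (leb (xsection A x) <= leb `[a, b]%classic)%E.
    apply: le_measure; rewrite ?inE.
    - exact: measurable_xsection.
    - exact: measurable_itv.
    - by move=> y; rewrite /xsection/= inE in_itv/= => /H.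
  by move=> h; apply: (le_trans h); rewrite lebesgue_itvcc// lee_fin.
- move=> x xI /=; rewrite (_ : xsection A x = set0) ?measure0//.
  apply/seteqP; split=> // y; rewrite /xsection/= inE => /Arho/=.
  by rewrite ler_norml; move: xI; rewrite in_itv/= => /negP.
Qed.

Lemma area2_ysection (rho k : R) A : plane_measurable A -> 0 <= rho ->
  (forall p, A p -> `|p.2| <= rho) ->
  (forall y, exists a b, [/\ a <= b, b - a <= k & forall x, A (x, y) -> a <= x <= b]) ->
  (area2 A <= (2 * rho * k)%:E)%E.
Proof.
move=> mA r0 Arho Ak; rewrite area2_swapE//; apply: integral_le_box => //.
- exact: measurable_fun_ysection.
- move=> x /=; have [a [b [ab bak H]]] := Ak x.
  have : (leb (ysection A x) <= leb `[a, b]%classic)%E.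
    apply: le_measure; rewrite ?inE.
    - exact: measurable_ysection.
    - exact: measurable_itv.
    - by move=> y; rewrite /ysection/= inE in_itv/= => /H.
  by move=> h; apply: (le_trans h); rewrite lebesgue_itvcc// lee_fin.
- move=> x xI /=; rewrite (_ : ysection A x = set0) ?measure0//.
  apply/seteqP; split=> // y; rewrite /ysection/= inE => /Arho/=.
  by rewrite ler_norml; move: xI; rewrite in_itv/= => /negP.
Qed.

(** The part of a box at distance at most [e] from the line through 0 with
    polar angle [a]. *)
Definition strip (rho a e : R) : set (R * R) :=
  box rho `&` [set p | `|cos a * p.2 - sin a * p.1| <= e].

Lemma plane_measurable_strip rho a e : plane_measurable (strip rho a e).
Proof.
apply: measurableI; first exact: plane_measurable_box.
have -> : [set p : R * R | `|cos a * p.2 - sin a * p.1| <= e] =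
  [set p | - e <= - sin a * p.1 + cos a * p.2] `&`
  [set p | - sin a * p.1 + cos a * p.2 <= e].
  apply/seteqP; split=> p /=; rewrite ler_norml.
    by move=> /andP[? ?]; split; lra.
  by move=> [? ?]; apply/andP; split; lra.
by apply: measurableI; apply: plane_measurable_le => //; exact: plane_measurable_linear.
Qed.

(** One of [cos a] and [sin a] is at least 1/2 in absolute value, so the sections
    of the strip in one of the two coordinate directions have length at most
    [4 * e]. *)
Lemma area2_strip rho a e : 0 <= rho -> 0 <= e ->
  (area2 (strip rho a e) <= (2 * rho * (4 * e))%:E)%E.
Proof.
move=> r0 e0.
have key (c d x : R) : 1 / 2 <= `|c| -> exists u v, [/\ u <= v, v - u <= 4 * e &
    forall y, `|c * y - d * x| <= e -> u <= y <= v].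
  move=> c0; have cn0 : 0 < `|c| by lra.
  have cu : c != 0 by rewrite -normr_gt0.
  exists (d * x / c - e / `|c|), (d * x / c + e / `|c|).
  have ec : e / `|c| <= 2 * e by rewrite ler_pdivrMr//; nra.
  have ec0 : 0 <= e / `|c| by rewrite divr_ge0.
  split; [lra|lra|move=> y H].
  have : `|y - d * x / c| <= e / `|c|.
    rewrite ler_pdivlMr// -normrM mulrBl divfK//.
    by rewrite [y * c]mulrC.
  by rewrite ler_norml => /andP[? ?]; apply/andP; split; lra.
have [c0|c0] := leP (1 / 2) `|cos a|.
  apply: area2_xsection => //; first exact: plane_measurable_strip.
    by move=> p [] [+ _] _; rewrite /= in_itv/= ler_norml.
  move=> x; have [u [v [uv vu H]]] := key (cos a) (sin a) x c0.
  by exists u, v; split=> // y [_ /H].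
have s0 : 1 / 2 <= `|sin a|.
  rewrite leNgt; apply/negP => s0.
  have := cos2Dsin2 a; rewrite -(real_normK (num_real (cos a))) -(real_normK (num_real (sin a))).
  have := normr_ge0 (cos a); have := normr_ge0 (sin a); nra.
apply: area2_ysection => //; first exact: plane_measurable_strip.
  by move=> p [] [_ +] _; rewrite /= in_itv/= ler_norml.
move=> y; have [u [v [uv vu H]]] := key (sin a) (cos a) y s0.
by exists u, v; split=> // x [_ /=]; rewrite distrC => /H.
Qed.

Lemma le_norm_sin (x : R) : `|sin x| <= `|x|.
Proof.
wlog x0 : x / 0 <= x.
  move=> wl; have [/wl//|/ltW x0] := leP 0 x.
  by have := wl (- x); rewrite sinN !normrN oppr_ge0; exact.
have [|s sI] := @MVT_segment _ sin cos 0 x x0 _.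
  exact/continuous_subspaceT/continuous_sin.
rewrite sin0 !subr0 => ->; rewrite normrM -[leRHS]mul1r ler_wpM2r//.
exact: cos_max.
Qed.

Lemma radius_polar (r phi : R) : 0 <= r -> radius (polar_pt r phi) = r.
Proof.
move=> r0; rewrite /radius/= !exprMn -mulrDr cos2Dsin2 mulr1 sqrtr_sqr.
by rewrite ger0_norm.
Qed.

Lemma polar_upper p : 0 <= p.2 ->
  exists2 phi, 0 <= phi <= pi & p = polar_pt (radius p) phi.
Proof.
case: p => x y /= y0.
have [r0|r0] := eqVneq (radius (x, y)) 0.
  exists 0; first by rewrite lexx pi_ge0.
  rewrite r0 /polar_pt !mul0r.
  move: r0; rewrite /radius/= => /eqP; rewrite sqrtr_eq0 => h.
  by congr (_, _); apply/eqP; rewrite -sqrf_eq0; apply/eqP;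
    have := sqr_ge0 x; have := sqr_ge0 y; lra.
have rp : 0 < radius (x, y) by rewrite lt_neqAle eq_sym r0 sqrtr_ge0.
have rE : radius (x, y) ^+ 2 = x ^+ 2 + y ^+ 2.
  by rewrite sqr_sqrtr// addr_ge0 ?sqr_ge0.
move: (radius (x, y)) r0 rp rE => r r0 rp rE.
have xr : -1 <= x / r <= 1.
  rewrite -ler_norml normrM normfV (gtr0_norm rp) ler_pdivrMr// mul1r.
  rewrite -ler_sqr ?nnegrE ?(ltW rp)// real_normK ?num_real// rE.
  by rewrite lerDl sqr_ge0.
exists (acos (x / r)); first by rewrite acos_ge0// acos_lepi.
rewrite /polar_pt acosK ?in_itv//= sin_acos//.
congr (_, _); first by rewrite mulrC divfK.
have -> : 1 - (x / r) ^+ 2 = (y / r) ^+ 2.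
  rewrite !expr_div_n -{1}(@divff _ (r ^+ 2)) ?expf_neq0// -mulrBl; congr (_ / _).
  by rewrite rE addrC addKr.
by rewrite sqrtr_sqr ger0_norm ?divr_ge0 ?(ltW rp)// mulrC divfK.
Qed.

End area.

(** * Areas of sectors and existence of boundary points *)

Section sectors.
Context {R : realType}.
Implicit Types (K : set (R * R)) (p : R * R).

(** The union of the rays with polar angles in [ [0, a] ], described by
    inequalities from which its measurability can be read off. *)
Definition wedge (a : R) : set (R * R) :=
  if a <= pi then [set p | 0 <= p.2] `&` [set p | radius p * cos a <= p.1]
  else [set p | 0 <= p.2] `|` [set p | p.1 <= radius p * cos a].

Lemma plane_measurable_wedge a : plane_measurable (wedge a).
Proof.
have mr : @measurable_fun _ _ (measurableTypeR R * measurableTypeR R)%type R setT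
    (fun p => radius p * cos a).
  by apply: measurable_funM => //; exact: plane_measurable_radius.
have m2 : plane_measurable [set p : R * R | 0 <= p.2].
  by apply: plane_measurable_le => //; exact: plane_measurable_snd.
rewrite /wedge; case: ifP => _.
  by apply: measurableI => //; apply: plane_measurable_le => //; exact: plane_measurable_fst.
by apply: measurableU => //; apply: plane_measurable_le => //; exact: plane_measurable_fst.
Qed.

Lemma cos_2pi_sub (a : R) : cos (2 * pi - a) = cos a.
Proof. by rewrite -[RHS]cosN -[RHS]cosD2pi; congr cos; ring. Qed.

Lemma sin_2pi_sub (a : R) : sin (2 * pi - a) = - sin a.
Proof. by rewrite -[RHS]sinN -[RHS]sinD2pi; congr sin; ring. Qed.

Lemma wedgeP a p : 0 <= a <= 2 * pi -> wedge a p <->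
  exists r phi : R, [/\ 0 <= r, 0 <= phi <= a & p = polar_pt r phi].
Proof.
move=> /andP[a0 a2]; have pi0 := pi_gt0 R.
have cos_le (x y : R) : 0 <= x <= pi -> 0 <= y <= pi -> (cos x <= cos y) = (y <= x).
  by move=> xI yI; rewrite leNgt ltr_cos ?in_itv//= -leNgt.
split; last first.
  move=> [r [phi [r0 /andP[p0 pa] ->]]]; rewrite /wedge.
  case: ifP => [ap|/negbT].
    split=> /=; first by rewrite mulr_ge0// sin_ge0_pi// p0 (le_trans pa).
    by rewrite radius_polar// ler_wpM2l// cos_le ?a0 ?p0//= (le_trans pa).
  rewrite -ltNge => pia.
  have [pp|pp] := leP phi pi.
    by left; rewrite /= mulr_ge0// sin_ge0_pi// p0.
  right; rewrite /= radius_polar// ler_wpM2l// -(cos_2pi_sub phi) -(cos_2pi_sub a).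
  by rewrite cos_le; try (apply/andP; split); lra.
have [p2|p2] := leP 0 p.2.
  have [phi /andP[phi0 phipi] pE] := polar_upper p2.
  rewrite /wedge; case: ifP => [api|/negbT]; last first.
    rewrite -ltNge => pia _; exists (radius p), phi; split=> //.
      exact: sqrtr_ge0.
    by rewrite phi0; lra.
  move=> [_] /= H.
  have [r0|r0] := eqVneq (radius p) 0.
    exists 0, 0; split=> //; first by rewrite lexx.
    by rewrite pE r0 /polar_pt !mul0r.
  have rp : 0 < radius p by rewrite lt_neqAle eq_sym r0 sqrtr_ge0.
  exists (radius p), phi; split => //; first exact: ltW.
  rewrite phi0/= -cos_le ?a0 ?phi0//.
  by move: H; rewrite {2}pE/= ler_pM2l.
rewrite /wedge; case: ifP => [api [/=]|/negbT]; first by rewrite leNgt p2.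
rewrite -ltNge => pia [/=|/= H]; first by rewrite leNgt p2.
have [|phi /andP[phi0 phipi] qE] := @polar_upper R (p.1, - p.2).
  by rewrite /= oppr_ge0 ltW.
have rE : radius (p.1, - p.2) = radius p by rewrite /radius/= sqrrN.
move: qE; rewrite rE => -[p1 p2E].
have pE : p = polar_pt (radius p) (2 * pi - phi).
  rewrite /polar_pt cos_2pi_sub sin_2pi_sub mulrN -p2E opprK -p1.
  by case: (p).
have r0 : radius p != 0.
  by apply/eqP => r0; move: p2; rewrite -[p.2]opprK p2E r0 mul0r oppr0 ltxx.
have rp : 0 < radius p by rewrite lt_neqAle eq_sym r0 sqrtr_ge0.
exists (radius p), (2 * pi - phi); split=> //; first exact: ltW.
move: H; rewrite p1 ler_pM2l// -(cos_2pi_sub a) cos_le; last 2 first.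
- by rewrite phi0.
- by apply/andP; split; lra.
by move=> H; apply/andP; split; lra.
Qed.

Lemma sectorE K a : 0 <= a <= 2 * pi -> sector K a = K `&` wedge a.
Proof.
by move=> aI; apply/seteqP; split=> p [Kp H]; split=> //; apply/(wedgeP _ aI).
Qed.

Section bounded.
Variables (K : set (R * R)) (rho : R).
Hypotheses (mK : plane_measurable K) (rho0 : 0 <= rho) (Kbox : K `<=` box rho).

Lemma plane_measurable_sector a : 0 <= a <= 2 * pi -> plane_measurable (sector K a).
Proof.
move=> aI; rewrite sectorE//; apply: measurableI => //.
exact: plane_measurable_wedge.
Qed.

Lemma area2_fin A : plane_measurable A -> A `<=` K -> area2 A \is a fin_num.
Proof.
move=> mA AK; rewrite ge0_fin_numE; last by rewrite area2E.
apply: (@le_lt_trans _ _ (area2 (box rho))).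
  by apply: area2_le => //; [exact: plane_measurable_box|exact: subset_trans Kbox].
by rewrite area2_box// ltry.
Qed.

Lemma sector_subK a : sector K a `<=` K. Proof. by move=> p []. Qed.

Let F a : R := fine (area2 (sector K a)).

Let FE a : 0 <= a <= 2 * pi -> area2 (sector K a) = (F a)%:E.
Proof.
by move=> aI; rewrite fineK// area2_fin//; [exact: plane_measurable_sector|exact: sector_subK].
Qed.

Lemma sector_mono a b : a <= b -> sector K a `<=` sector K b.
Proof.
move=> ab p [Kp [r [phi [r0 /andP[p0 pa] pE]]]]; split=> //.
by exists r, phi; rewrite r0 p0 (le_trans pa ab).
Qed.

(** A point of a bounded set whose polar angle is slightly beyond [a] is close
    to the ray of angle [a].  This is the modulus of continuity of the area of
    sectors. *)
Lemma sector_step a b : a <= b ->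
  sector K b `<=` sector K a `|` strip rho a (2 * rho * (b - a)).
Proof.
move=> ab p [Kp [r [phi [r0 /andP[p0 pb] pE]]]].
have [pa|ap] := leP phi a; [left|right].
  by split=> //; exists r, phi; rewrite r0 p0 pa.
split; first exact: Kbox.
move: (Kbox Kp); rewrite pE => -[] /=; rewrite !in_itv/= -!ler_norml => h1 h2.
have r2 : r <= 2 * rho.
  have sq (x : R) : `|x| <= rho -> x ^+ 2 <= rho ^+ 2.
    by move=> xr; rewrite -(real_normK (num_real x)) ler_sqr ?nnegrE.
  have rE : r ^+ 2 = (r * cos phi) ^+ 2 + (r * sin phi) ^+ 2.
    by rewrite !exprMn -mulrDr cos2Dsin2 mulr1.
  rewrite -ler_sqr ?nnegrE ?mulr_ge0// rE.
  by have := sq _ h1; have := sq _ h2; have := sqr_ge0 rho; lra.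
have -> : cos a * (r * sin phi) - sin a * (r * cos phi) = r * sin (phi - a).
  by rewrite sinB; ring.
rewrite /= normrM (ger0_norm r0) ler_pM//.
by rewrite (le_trans (le_norm_sin _))// ger0_norm ?subr_ge0 ?(ltW ap)// lerD2r.
Qed.

Let F_mono a b : 0 <= a -> a <= b -> b <= 2 * pi -> F a <= F b.
Proof.
move=> a0 ab b2.
have aI : 0 <= a <= 2 * pi by rewrite a0 (le_trans ab).
have bI : 0 <= b <= 2 * pi by rewrite b2 (le_trans a0).
have := area2_le (plane_measurable_sector aI) (plane_measurable_sector bI) (sector_mono ab).
by rewrite (FE aI) (FE bI) lee_fin.
Qed.

Let F_lip a b : 0 <= a -> a <= b -> b <= 2 * pi ->
  F b - F a <= 16 * rho ^+ 2 * (b - a).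
Proof.
move=> a0 ab b2.
have aI : 0 <= a <= 2 * pi by rewrite a0 (le_trans ab).
have bI : 0 <= b <= 2 * pi by rewrite b2 (le_trans a0).
have e0 : 0 <= 2 * rho * (b - a) by rewrite mulr_ge0 ?subr_ge0// mulr_ge0.
rewrite lerBlDl -lee_fin EFinD -(FE aI) -(FE bI).
apply: (@le_trans _ _ (area2 (sector K a `|` strip rho a (2 * rho * (b - a))))).
  apply: area2_le; [exact: plane_measurable_sector| |exact: sector_step].
  by apply: measurableU; [exact: plane_measurable_sector|exact: plane_measurable_strip].
apply: le_trans (area2U_le _ _) _; [exact: plane_measurable_sector|exact: plane_measurable_strip|].
apply: leeD => //; apply: le_trans (area2_strip _ rho0 e0) _.
by rewrite lee_fin; nra.
Qed.

Let F0 : F 0 = 0.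
Proof.
have pi0 := pi_gt0 R.
apply/eqP; rewrite eq_le; apply/andP; split; last first.
  by rewrite fine_ge0// area2E.
rewrite -lee_fin -FE; last by rewrite lexx/=; lra.
have <- : (2 * rho * (4 * 0))%:E = 0%:E :> \bar R by congr _%:E; ring.
apply: le_trans (area2_strip 0 rho0 (lexx 0)).
apply: area2_le; [apply: plane_measurable_sector|exact: plane_measurable_strip|].
  by rewrite lexx/=; lra.
move=> p [Kp [r [phi [r0 /andP[p0 p1] pE]]]].
have phi0 : phi = 0 by apply/eqP; rewrite eq_le p1.
split; first exact: Kbox.
by rewrite pE phi0 /= sin0 !mulr0 mul0r subr0 normr0.
Qed.

Let F2pi : F (2 * pi) = area K.
Proof.
have pi0 := pi_gt0 R.
congr fine; congr area2; rewrite sectorE; last by rewrite lexx andbT; lra.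
apply/seteqP; split=> [p []//|p Kp]; split=> //.
rewrite /wedge; case: ifP => [|_]; first lra.
right; rewrite /= -[2 * pi]subr0 cos_2pi_sub cos0 mulr1.
rewrite (le_trans (ler_norm _))// /radius -sqrtr_sqr ler_wsqrtr// lerDl.
exact: sqr_ge0.
Qed.

(** Intermediate value theorem for the area of the sector of angle [a], which
    runs from 0 to the area of [K] as [a] runs from 0 to [2 * pi]. *)
Lemma sector_area_onto s : 0 <= s < area K ->
  exists2 a, 0 <= a < 2 * pi & area2 (sector K a) = s%:E.
Proof.
move=> /andP[s0 sK]; have pi0 := pi_gt0 R.
have ts : {within `[0, 2 * pi], continuous F}.
  apply: (@lipschitz_within_continuous _ F (16 * rho ^+ 2)) => x y.
  wlog xy : x y / x <= y.
    by move=> wl xI yI; have [/wl|/ltW/wl H] := leP x y; [apply|rewrite distrC [`|x - y|]distrC H].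
  rewrite !in_itv/= => /andP[x0 x2] /andP[y0 y2].
  have Fxy : 0 <= F y - F x by rewrite subr_ge0; exact: F_mono.
  have yx : 0 <= y - x by rewrite subr_ge0.
  rewrite [`|F x - F y|]distrC [`|x - y|]distrC (ger0_norm Fxy) (ger0_norm yx).
  exact: F_lip.
have [||a] := @IVT _ F 0 (2 * pi) s _ ts; first lra.
  rewrite F0 F2pi; have K0 : 0 <= area K by lra.
  by rewrite min_l// max_r// s0 ltW.
rewrite in_itv/= => /andP[a0 a2] Fa; exists a; last by rewrite FE ?a0// Fa.
rewrite a0 lt_neqAle a2 andbT; apply/eqP => aE.
by move: sK; rewrite -Fa aE F2pi ltxx.
Qed.

Hypothesis Krays : forall a, exists2 r, 0 < r & boundary K (polar_pt r a).
Hypothesis Karea : 0 < area K.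

Lemma reduce_mod_itv (T x : R) : 0 < T -> 0 <= reduce_mod T x < T.
Proof.
move=> T0; rewrite /reduce_mod.
have /andP[h1 h2] := real_floor_itv (num_real (x / T)).
apply/andP; split.
  by rewrite subr_ge0 -ler_pdivlMr.
by move: h2; rewrite intrD ltr_pdivrMr//; lra.
Qed.

Lemma trig_point_exists psi : is_trig_point K (reduce_mod (period K) psi) (trig_point K psi).
Proof.
have T0 : 0 < period K by rewrite mulr_gt0.
have /andP[h1 h2] := reduce_mod_itv psi T0.
have [|a aI aE] := @sector_area_onto (reduce_mod (period K) psi / 2).
  by move: h2; rewrite /period => h2; apply/andP; split; lra.
have [r r0 bK] := Krays a.
rewrite /trig_point; apply: xgetPex; exists (polar_pt r a).
by split=> //; exists r, a.
Qed.

End bounded.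
End sectors.

(** * Maximisers of linear forms over a polygon *)

Lemma seq_argmax (T : eqType) (r : rel T) (s : seq T) : total r -> transitive r ->
  s != [::] -> exists2 b, b \in s & forall z, z \in s -> r z b.
Proof.
move=> tr trr; elim: s => [//|x [|y s] IH] _.
  exists x; rewrite ?mem_head// => p; rewrite inE => /eqP ->.
  by have := tr x x; rewrite orbb.
have [//|b bs bmax] := IH.
have [xb|bx] := orP (tr x b).
  exists b; first by rewrite inE bs orbT.
  by move=> p; rewrite inE => /predU1P[->//|/bmax].
exists x; first by rewrite mem_head.
move=> p; rewrite inE => /predU1P[->|/bmax pb]; last exact: trr bx.
by have := tr x x; rewrite orbb.
Qed.

Section polygon.
Context {R : realType}.
Implicit Types (p q : R * R).

Lemma pairing_polar (r a : R) p : pairing (polar_pt r a) p = r * pairing (polar_pt 1 a) p.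
Proof. by rewrite /pairing/= !mul1r mulrDr !mulrA. Qed.

Lemma closed_halfplane q (c : R) : closed [set p | pairing q p <= c].
Proof.
rewrite (_ : [set p | _] = pairing q @^-1` [set x | x <= c])//.
apply: preimage_closed; last exact: closed_le.
move=> p _; apply: (@continuousD _ _ _ (fun p => q.1 * p.1) (fun p => q.2 * p.2)).
  by apply: continuousM; [exact: cst_continuous|exact: cvg_fst].
by apply: continuousM; [exact: cst_continuous|exact: cvg_snd].
Qed.

Lemma convex_halfplane q (c : R) :
  @convex_set R (R * R)%type [set p | pairing q p <= c].
Proof.
move=> x y l; rewrite !inE /= /pairing => xc yc.
have l0 : 0 <= l%:num by [].
have l1 : l%:num <= 1 by [].
have -> : conv l x y = (l%:num * x.1 + (1 - l%:num) * y.1,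
                        l%:num * x.2 + (1 - l%:num) * y.2) by [].
rewrite /=.
have : l%:num * (q.1 * x.1 + q.2 * x.2) <= l%:num * c by rewrite ler_wpM2l.
have : (1 - l%:num) * (q.1 * y.1 + q.2 * y.2) <= (1 - l%:num) * c.
  by rewrite ler_wpM2l// subr_ge0.
lra.
Qed.

Section hull.
Variable (V : set (R * R)).
Hypothesis finV : finite_set V.
Let Omega : set (R * R) := smallest (@convex_set R (R * R)%type) V.
Hypothesis Omega0 : Omega° (0, 0).

(** A closed half-plane is convex, so it contains the hull as soon as it contains
    the vertices. *)
Lemma hull_le q c : (forall p, V p -> pairing q p <= c) ->
  forall p, closure Omega p -> pairing q p <= c.
Proof.
move=> Vc p cp.
have H : Omega `<=` [set p | pairing q p <= c].
  move=> z Oz; apply: (Oz [set p | pairing q p <= c]); split => //.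
  exact: convex_halfplane.
have := closureS H cp.
by rewrite -(closure_id _).1//; exact: closed_halfplane.
Qed.

Lemma vertices_sub_hull : V `<=` Omega.
Proof. by move=> p Vp A [_]; apply. Qed.

Lemma hull_box : exists2 rho, 0 < rho & box rho `<=` Omega.
Proof.
have [[A B] /= [/nbhs_ballP[e1 /= e10 H1] /nbhs_ballP[e2 /= e20 H2]] H] :
  nbhs (0, 0) Omega by exact: Omega0.
have e0 : 0 < Num.min e1 e2 by rewrite lt_min e10.
exists (Num.min e1 e2 / 2); first by rewrite divr_gt0.
have le1 : Num.min e1 e2 <= e1 by rewrite ge_min lexx.
have le2 : Num.min e1 e2 <= e2 by rewrite ge_min lexx orbT.
move=> [x y] [] /=; rewrite !in_itv/= => /andP[? ?] /andP[? ?].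
by apply: H; split=> /=; [apply: H1|apply: H2]; rewrite /ball/= sub0r normrN ltr_norml;
  apply/andP; split; lra.
Qed.

(** The lexicographic order on pairs of values is total, and [V] is finite and,
    as its hull is, nonempty. *)
Lemma lex_argmax (f g : R * R -> R) : exists2 B, V B &
  forall p, V p -> f p < f B \/ (f p = f B /\ g p <= g B).
Proof.
have /finite_seqP[s Vs] := finV.
pose r : rel (R * R) := fun p b => (f p < f b) || ((f p == f b) && (g p <= g b)).
have tr : total r.
  move=> x y; rewrite /r; have [//|//|fE] := ltgtP (f x) (f y).
  by rewrite /= le_total.
have trr : transitive r.
  move=> y x z; rewrite /r => /orP[xy|/andP[/eqP xy gxy]] /orP[yz|/andP[/eqP yz gyz]].
  - by rewrite (lt_trans xy yz).
  - by rewrite -yz xy.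
  - by rewrite xy yz.
  - by rewrite xy yz eqxx (le_trans gxy gyz) orbT.
have s0 : s != [::].
  apply/eqP => s0; have V0 : V = set0 by rewrite Vs s0; exact: set_nil.
  have := nbhs_singleton Omega0; apply: (_ : ~ Omega (0, 0)).
  move=> /(_ set0); apply; split; last by rewrite V0.
  by move=> x y l; rewrite inE.
have [b bs H] := seq_argmax tr trr s0.
exists b; first by rewrite Vs.
move=> p; rewrite Vs /= => /H /orP[?|/andP[/eqP ? ?]]; [by left|by right].
Qed.

Let dir a : R * R := polar_pt 1 a.

Lemma exists_pairing_gt0 q : q <> (0, 0) -> exists2 p, Omega p & 0 < pairing q p.
Proof.
move=> q0; have [rho rho0 H] := hull_box.
have n0 : 0 < `|q.1| + `|q.2|.
  rewrite lt_neqAle addr_ge0// andbT eq_sym paddr_eq0// !normr_eq0.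
  by apply/negP => /andP[/eqP q1 /eqP q2]; apply: q0; case: (q) q1 q2 => ? ? /= -> ->.
pose c := rho / (`|q.1| + `|q.2|).
have c0 : 0 < c by rewrite divr_gt0.
exists (c * q.1, c * q.2).
  apply: H; split; rewrite /= in_itv/= -ler_norml normrM gtr0_norm// /c -mulrA;
    rewrite ler_piMr ?(ltW rho0)// mulrC ler_pdivrMr// mul1r ?lerDl ?lerDr//.
rewrite /pairing/=.
have -> : q.1 * (c * q.1) + q.2 * (c * q.2) = c * (q.1 ^+ 2 + q.2 ^+ 2) by ring.
rewrite mulr_gt0// lt_neqAle addr_ge0 ?sqr_ge0// andbT eq_sym paddr_eq0 ?sqr_ge0//.
rewrite !sqrf_eq0; apply/negP => /andP[/eqP q1 /eqP q2].
by apply: q0; case: (q) q1 q2 => ? ? /= -> ->.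
Qed.

(** In the direction [a + sg * h] the linear form is
    [cos h * f p + sin h * g p], where [f] is its value in the direction [a] and
    [g] is [sg] times its derivative with respect to the angle.  For small
    positive [h] it is compared by [f] first and by [g] in case of a tie. *)
Lemma maximizer_near_direction a (sg : R) : sg ^+ 2 = 1 -> exists2 B, V B &
  exists2 e, 0 < e & forall h, 0 < h < e -> forall p, V p ->
    pairing (dir (a + sg * h)) p <= pairing (dir (a + sg * h)) B.
Proof.
move=> sg1.
pose g := fun p => sg * pairing (- sin a, cos a) p.
have [B VB H] := lex_argmax (pairing (dir a)) g.
exists B => //.
have sgE (h : R) : cos (sg * h) = cos h /\ sin (sg * h) = sg * sin h.
  move: sg1 => /eqP; rewrite sqrf_eq1 => /orP[]/eqP ->.
    by rewrite !mul1r.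
  by rewrite !mulN1r cosN sinN.
have dirE h p : pairing (dir (a + sg * h)) p =
    cos h * pairing (dir a) p + sin h * g p.
  have [ch sh] := sgE h.
  by rewrite /pairing /dir /= /g /pairing/= cosD sinD ch sh; ring.
have eps p : V p -> exists2 e, 0 < e & forall h, 0 < h < e ->
    pairing (dir (a + sg * h)) p <= pairing (dir (a + sg * h)) B.
  move=> Vp; have [fp|[fp gp]] := H p Vp; last first.
    exists pi; first exact: pi_gt0.
    by move=> h hI; rewrite !dirE fp lerD2l ler_wpM2l// ltW// sin_gt0_pi.
  pose k h := cos h * (pairing (dir a) B - pairing (dir a) p) + sin h * (g B - g p).
  have ck : {for 0, continuous k}.
    apply: (@continuousD _ _ _ (fun h => cos h * _) (fun h => sin h * _)).
      by apply: continuousM; [exact: continuous_cos|exact: cst_continuous].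
    by apply: continuousM; [exact: continuous_sin|exact: cst_continuous].
  have k0 : 0 < k 0 by rewrite /k cos0 sin0 mul0r addr0 mul1r subr_gt0.
  have /cvgr_gt /(_ _ k0) [e /= e0 He] := ck.
  exists e => // h /andP[h0 he]; rewrite !dirE.
  have := He h; rewrite /k /= sub0r normrN gtr0_norm// => /(_ he); lra.
have /finite_seqP[s Vs] := finV.
rewrite Vs in eps *.
elim: s {Vs} eps => [|x s IH] eps; first by exists 1.
have [e1 e10 H1] := eps x (mem_head _ _).
have [|e2 e20 H2] := IH; first by move=> p ps; apply: eps; rewrite /= inE ps orbT.
exists (Num.min e1 e2); first by rewrite lt_min e10.
move=> h /andP[h0]; rewrite lt_min => /andP[he1 he2] p /=.
rewrite inE => /predU1P[->|ps]; first by apply: H1; rewrite h0.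
by apply: H2; rewrite ?h0.
Qed.

(** If [B] is a maximiser for all directions around [a] and [P] for [a] itself,
    then [b |-> pairing (dir b) (P - B)] is nonpositive and vanishes at [a], so
    its derivative vanishes at [a] too; value and derivative are the
    coordinates of [P - B] in an orthonormal basis. *)
Lemma maximizer_unique (l r a : R) B P : V B -> l < a < r ->
  (forall b, l < b < r -> forall p, V p -> pairing (dir b) p <= pairing (dir b) B) ->
  closure Omega P -> (forall p, Omega p -> pairing (dir a) p <= pairing (dir a) P) ->
  P = B.
Proof.
move=> VB /andP[la ar] Bmax cP Pmax.
pose dx := P.1 - B.1; pose dy := P.2 - B.2.
have le b : l < b < r -> cos b * dx + sin b * dy <= 0.
  move=> bI; have := hull_le (Bmax b bI) cP.
  by rewrite /pairing /dir/= !mul1r /dx /dy; lra.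
have a0 : cos a * dx + sin a * dy = 0.
  apply/eqP; rewrite eq_le le ?la//=.
  have := Pmax B (vertices_sub_hull VB); rewrite /pairing /dir/= !mul1r /dx /dy; lra.
pose h := Num.min (Num.min ((a - l) / 2) ((r - a) / 2)) 1.
have h0 : 0 < h by rewrite !lt_min; apply/andP; split; lra.
have hl : h <= (a - l) / 2 by rewrite !ge_min lexx.
have hr : h <= (r - a) / 2 by rewrite !ge_min lexx orbT.
have h1 : h <= 1 by rewrite ge_min lexx orbT.
have sh : 0 < sin h by apply: sin2_gt0; rewrite h0; lra.
have perp : - sin a * dx + cos a * dy = 0.
  have e1 : sin h * (- sin a * dx + cos a * dy) <= 0.
    have := le (a + h); rewrite cosD sinD => H.
    have {}H := H ltac:(by apply/andP; split; lra).
    have -> : sin h * (- sin a * dx + cos a * dy) = (cos a * cos h - sin a * sin h) * dx +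
      (sin a * cos h + cos a * sin h) * dy - cos h * (cos a * dx + sin a * dy) by ring.
    by rewrite a0 mulr0 subr0.
  have e2 : 0 <= sin h * (- sin a * dx + cos a * dy).
    have := le (a - h); rewrite cosB sinB => H.
    have {}H := H ltac:(by apply/andP; split; lra).
    have -> : sin h * (- sin a * dx + cos a * dy) = - ((cos a * cos h + sin a * sin h) * dx +
      (sin a * cos h - cos a * sin h) * dy - cos h * (cos a * dx + sin a * dy)) by ring.
    by rewrite a0 mulr0 subr0 oppr_ge0.
  have /eqP : sin h * (- sin a * dx + cos a * dy) = 0 by apply/eqP; rewrite eq_le e1.
  by rewrite mulf_eq0 gt_eqF//= => /eqP.
have cs := cos2Dsin2 a.
have dx0 : dx = 0.
  have -> : dx = cos a * (cos a * dx + sin a * dy) - sin a * (- sin a * dx + cos a * dy)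
      + (1 - (cos a ^+ 2 + sin a ^+ 2)) * dx by ring.
  by rewrite a0 perp cs; ring.
have dy0 : dy = 0.
  have -> : dy = sin a * (cos a * dx + sin a * dy) + cos a * (- sin a * dx + cos a * dy)
      + (1 - (cos a ^+ 2 + sin a ^+ 2)) * dy by ring.
  by rewrite a0 perp cs; ring.
move: dx0 dy0; rewrite /dx /dy => /eqP; rewrite subr_eq0 => /eqP e1 /eqP.
by rewrite subr_eq0 => /eqP e2; case: (P) (B) e1 e2 => ? ? [? ?] /= -> ->.
Qed.

End hull.
End polygon.

(** * The polar polygon *)

(** Strict monotonicity prevents [f] from attaining its right limit; this
    puts its values on one side of the limit without any continuity. *)
Lemma mono_right_limit {R : realType} (f : R -> R) (v d m : R) : v < d ->
  (forall x y, v < x -> x < y -> y < d -> f x < f y) ->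
  (forall x, v < x -> x < d -> m <= f x) ->
  exists a, forall e, 0 < e -> exists2 d', v < d' & forall x, v < x -> x < d' ->
    a < f x < a + e.
Proof.
move=> vd mono fm.
pose E := [set f x | x in `]v, d[].
have mid (x y : R) : x < y -> x < (x + y) / 2 < y by move=> ?; apply/andP; split; lra.
have /andP[m1 m2] := mid _ _ vd.
have hE : has_inf E.
  split; first by exists (f ((v + d) / 2)); exists ((v + d) / 2) => //=; rewrite in_itv/= m1.
  by exists m => _ [x /= + <-]; rewrite in_itv/= => /andP[]; exact: fm.
exists (inf E) => e e0.
have [_ [x /= + <-] fx] := inf_adherent e0 hE.
rewrite in_itv/= => /andP[vx xd].
exists x => // y vy yx.
rewrite (lt_trans (mono _ _ vy yx xd) fx) andbT.
have /andP[vz zy] := mid _ _ vy.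
apply: (@le_lt_trans _ _ (f ((v + y) / 2))); last by apply: mono => //; lra.
apply: ge_inf; first exact: hE.2.
by exists ((v + y) / 2) => //=; rewrite in_itv/= vz; lra.
Qed.

Section polar.
Context {R : realType}.
Implicit Types (p q : R * R).
Variable (V : set (R * R)).
Hypothesis finV : finite_set V.
Let Omega : set (R * R) := smallest (@convex_set R (R * R)%type) V.
Hypothesis Omega0 : Omega° (0, 0).
Let K := polar_set Omega.

Lemma polar_setE : K = \bigcap_(p in V) [set q | pairing q p <= 1].
Proof.
apply/seteqP; split=> [q Kq p Vp|q Kq p Op].
  by apply: Kq; exact: vertices_sub_hull.
apply: (@hull_le _ V q 1); last exact: subset_closure.
by move=> z Vz; exact: Kq.
Qed.

Lemma plane_measurable_polar : plane_measurable K.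
Proof.
rewrite polar_setE.
apply: (@fin_bigcap_measurable _ (measurableTypeR R * measurableTypeR R)%type)
  => //.
move=> p _; apply: plane_measurable_le => //.
apply: (measurable_funD (f := fun q => q.1 * p.1) (g := fun q => q.2 * p.2)).
  by apply: measurable_funM => //; exact: plane_measurable_fst.
by apply: measurable_funM => //; exact: plane_measurable_snd.
Qed.

Lemma polar_box : exists2 rho, 0 <= rho & K `<=` box rho.
Proof.
have [rho rho0 H] := @hull_box _ V Omega0.
exists rho^-1; first by rewrite invr_ge0 ltW.
move=> q Kq.
have key (x y : R) : `|x| <= rho -> `|y| <= rho -> pairing q (x, y) <= 1.
  by move=> xr yr; apply: Kq; apply: H; split; rewrite /= in_itv/= -ler_norml.
have r1 : `|rho| <= rho by rewrite ger0_norm// ltW.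
have r2 : `|- rho| <= rho by rewrite normrN.
have r0 : `|0 : R| <= rho by rewrite normr0 ltW.
have h1 := key _ _ r1 r0; have h2 := key _ _ r2 r0.
have h3 := key _ _ r0 r1; have h4 := key _ _ r0 r2.
move: h1 h2 h3 h4; rewrite /pairing/= !mulr0 !addr0 !add0r !mulrN => h1 h2 h3 h4.
have le_inv x : x * rho <= 1 -> x <= rho^-1 by rewrite -[rho^-1]mul1r ler_pdivlMr.
have ge_inv x : - (x * rho) <= 1 -> - rho^-1 <= x.
  by move=> h; rewrite lerNl le_inv// mulNr.
by split; rewrite /= in_itv/= le_inv// ge_inv.
Qed.

Lemma box_polar : exists2 c, 0 < c & box c `<=` K.
Proof.
have [B VB HB] := @lex_argmax _ V finV Omega0 (fun p => `|p.1| + `|p.2|) (fun=> 0).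
pose N := `|B.1| + `|B.2| + 1.
have N0 : 0 < N by rewrite ltr_wpDl// addr_ge0.
exists N^-1; first by rewrite invr_gt0.
rewrite polar_setE => q [q1 q2] p Vp /=.
move: q1 q2; rewrite /= !in_itv/= -!ler_norml => q1 q2.
have pN : `|p.1| + `|p.2| <= N.
  by have [/ltW|[->]] := HB p Vp; rewrite /N; lra.
rewrite /pairing (le_trans (ler_norm _))// (le_trans (ler_normD _ _))// !normrM.
apply: (@le_trans _ _ (N^-1 * `|p.1| + N^-1 * `|p.2|)).
  by rewrite lerD// ler_wpM2r.
by rewrite -mulrDr mulrC ler_pdivrMr// mul1r.
Qed.

Lemma area_polar_gt0 : 0 < area K.
Proof.
have [c c0 cK] := box_polar; have [rho rho0 Kr] := polar_box.
have fK := area2_fin rho0 Kr plane_measurable_polar (@subset_refl _ K).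
rewrite /area -lte_fin fineK//.
apply: (@lt_le_trans _ _ (area2 (box c))).
  by rewrite area2_box ?(ltW c0)// lte_fin !mulr_gt0.
by apply: area2_le => //; [exact: plane_measurable_box|exact: plane_measurable_polar].
Qed.

(** On the ray of angle [a], the boundary point of the polar set is at distance
    [1 / max_(p in V) pairing (cos a, sin a) p]. *)
Lemma polar_rays a : exists2 r, 0 < r & boundary K (polar_pt r a).
Proof.
have [B VB HB] := @lex_argmax _ V finV Omega0 (pairing (polar_pt 1 a)) (fun=> 0).
have Bmax p : V p -> pairing (polar_pt 1 a) p <= pairing (polar_pt 1 a) B.
  by move=> /HB[/ltW//|[->]].
have m0 : 0 < pairing (polar_pt 1 a) B.
  have [|p Op p0] := @exists_pairing_gt0 _ V Omega0 (polar_pt 1 a).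
    rewrite /polar_pt !mul1r => -[c0 s0]; have := cos2Dsin2 a.
    by rewrite c0 s0 expr0n/= addr0; lra.
  apply: (lt_le_trans p0); apply: (hull_le Bmax); exact: subset_closure.
set m := pairing _ B in m0 Bmax.
exists m^-1; first by rewrite invr_gt0.
split.
  apply: subset_closure; rewrite polar_setE => p Vp /=.
  by rewrite pairing_polar mulrC ler_pdivrMr// mul1r Bmax.
move=> /= [[A1 A2] /= [/nbhs_ballP[e1 /= e10 H1] /nbhs_ballP[e2 /= e20 H2]] H].
pose e := Num.min e1 e2.
have e0 : 0 < e by rewrite lt_min e10.
have le1 : e <= e1 by rewrite ge_min lexx.
have le2 : e <= e2 by rewrite ge_min lexx orbT.
have small (x : R) : `|x| <= 1 -> `|m^-1 * x - (m^-1 + e / 2) * x| < e.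
  move=> x1; have -> : m^-1 * x - (m^-1 + e / 2) * x = - ((e / 2) * x) by ring.
  rewrite normrN normrM gtr0_norm ?divr_gt0//.
  have : e / 2 * `|x| <= e / 2 * 1 by rewrite ler_wpM2l// divr_ge0 ?ltW.
  lra.
have : K (polar_pt (m^-1 + e / 2) a).
  apply: H; split; [apply: H1|apply: H2]; rewrite /ball/=.
    by apply: lt_le_trans le1; apply: small; exact: cos_max.
  by apply: lt_le_trans le2; apply: small; exact: sin_max.
move=> /(_ B (@vertices_sub_hull _ V B VB)); rewrite pairing_polar -/m mulrDl mulVf ?gt_eqF//.
have e2m : 0 < e / 2 * m by rewrite !mulr_gt0.
lra.
Qed.

Lemma polar_trig_point psi : is_trig_point K (reduce_mod (period K) psi) (trig_point K psi).
Proof.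
have [rho rho0 Kr] := polar_box.
exact: trig_point_exists plane_measurable_polar rho0 Kr polar_rays area_polar_gt0 psi.
Qed.

Lemma polar_angle : exists r ang : R -> R, forall psi,
  [/\ 0 < r psi, 0 <= ang psi < 2 * pi, trig_point K psi = polar_pt (r psi) (ang psi) &
      area2 (sector K (ang psi)) = (reduce_mod (period K) psi / 2)%:E].
Proof.
have H psi : exists ra : R * R, [/\ 0 < ra.1, 0 <= ra.2 < 2 * pi,
    trig_point K psi = polar_pt ra.1 ra.2 &
    area2 (sector K ra.2) = (reduce_mod (period K) psi / 2)%:E].
  by have [_ [r [a [r0 aI PE aE]]]] := polar_trig_point psi; exists (r, a).
have [f Hf] := choice H.
by exists (fun x => (f x).1), (fun x => (f x).2).
Qed.

Lemma reduce_mod_mono (T : R) (k : int) x y : 0 < T ->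
  k%:~R * T <= x -> x < y -> y < (k + 1)%:~R * T -> reduce_mod T x < reduce_mod T y.
Proof.
move=> T0 kx xy yk.
have fl z : k%:~R * T <= z -> z < (k + 1)%:~R * T -> Num.floor (z / T) = k.
  by move=> kz zk; apply: floor_def; rewrite ler_pdivlMr// kz ltr_pdivrMr.
by rewrite /reduce_mod !fl ?ltrD2r// ?(lt_trans xy)// (le_trans kx)// ltW.
Qed.

(** The area of the sector of angle [ang psi] is [psi / 2] up to a constant on
    each period, and a sector of smaller angle has smaller area. *)
Lemma trig_angle_mono (r ang : R -> R) : (forall psi,
  [/\ 0 < r psi, 0 <= ang psi < 2 * pi, trig_point K psi = polar_pt (r psi) (ang psi) &
      area2 (sector K (ang psi)) = (reduce_mod (period K) psi / 2)%:E]) ->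
  forall (k : int) x y, k%:~R * period K <= x -> x < y -> y < (k + 1)%:~R * period K ->
  ang x < ang y.
Proof.
move=> H k x y kx xy yk.
have T0 : 0 < period K by rewrite mulr_gt0// area_polar_gt0.
have [_ /andP[ax0 ax2] _ Ax] := H x; have [_ /andP[ay0 ay2] _ Ay] := H y.
rewrite ltNge; apply/negP => yx.
have : (area2 (sector K (ang y)) <= area2 (sector K (ang x)))%E.
  apply: area2_le; last exact: sector_mono.
    by apply: (plane_measurable_sector plane_measurable_polar); rewrite ay0 ltW.
  by apply: (plane_measurable_sector plane_measurable_polar); rewrite ax0 ltW.
rewrite Ax Ay lee_fin; have := reduce_mod_mono T0 kx xy yk; lra.
Qed.

Definition exposes (psi : R) (B : R * R) : Prop := forall P, closure Omega P ->
  (forall p, Omega p -> pairing (trig_point K psi) p <= pairing (trig_point K psi) P) -> P = B.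

Lemma exposes_dir psi r a (l u : R) B : trig_point K psi = polar_pt r a -> 0 < r ->
  V B -> l < a < u ->
  (forall b, l < b < u -> forall p, V p ->
    pairing (polar_pt 1 b) p <= pairing (polar_pt 1 b) B) ->
  exposes psi B.
Proof.
move=> QE r0 VB aI Bmax P cP Pmax.
apply: (maximizer_unique VB aI Bmax cP) => p Op.
by have := Pmax p Op; rewrite QE !(pairing_polar r) ler_pM2l.
Qed.

Lemma exposes_right v : exists2 e, 0 < e & exists B, forall psi, v < psi < v + e -> exposes psi B.
Proof.
have [r [ang H]] := polar_angle.
have T0 : 0 < period K by rewrite mulr_gt0// area_polar_gt0.
pose k := Num.floor (v / period K).
have /andP[k1 k2] := real_floor_itv (num_real (v / period K)).
rewrite ler_pdivlMr// in k1; rewrite ltr_pdivrMr// in k2.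
have [||a Ha] := @mono_right_limit _ ang v ((k + 1)%:~R * period K) 0 k2.
- by move=> x y vx xy yk; apply: (trig_angle_mono H) xy yk; rewrite (le_trans k1)// ltW.
- by move=> x _ _; have [_ /andP[]] := H x.
have [|B VB [e e0 HB]] := @maximizer_near_direction _ V finV Omega0 a 1; first by rewrite expr1n.
have [d vd Hd] := Ha _ e0.
exists (d - v); first by rewrite subr_gt0.
exists B => psi; rewrite (_ : v + (d - v) = d); last ring.
move=> /andP[vp pd].
have [r0 _ QE _] := H psi.
apply: (exposes_dir QE r0 VB (Hd _ vp pd)) => b /andP[ab be] p Vp.
have := HB (b - a) _ p Vp; rewrite mul1r (_ : a + (b - a) = b); last ring.
by apply; apply/andP; split; lra.
Qed.

(** As [exposes_right], applied to the increasing function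
    [x |-> - ang (- x)]. *)
Lemma exposes_left v : exists2 e, 0 < e & exists B, forall psi, v - e < psi < v -> exposes psi B.
Proof.
have [r [ang H]] := polar_angle.
have T0 : 0 < period K by rewrite mulr_gt0// area_polar_gt0.
(* the period that precedes [v], which ends at [v] if [v] is a multiple of it *)
pose k : int := - Num.floor (- v / period K) - 1.
have /andP[k1 k2] := real_floor_itv (num_real (- v / period K)).
rewrite ler_pdivlMr// in k1; rewrite ltr_pdivrMr// in k2.
have kT : (k + 1)%:~R * period K = - ((Num.floor (- v / period K))%:~R * period K).
  by rewrite /k subrK mulrNz mulNr.
have kT' : k%:~R * period K = - ((Num.floor (- v / period K) + 1)%:~R * period K).
  by rewrite /k -opprD mulrNz mulNr.
have [||| a Ha] := @mono_right_limit _ (fun x => - ang (- x)) (- v)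
  (- (k%:~R * period K)) (- (2 * pi)).
- by rewrite ltrN2 kT'; lra.
- move=> x y vx xy yk; rewrite ltrN2; apply: (trig_angle_mono H (k := k)); lra.
- by move=> x _ _; have [_ /andP[_ h] _ _] := H (- x); rewrite lerN2 ltW.
have [|B VB [e e0 HB]] := @maximizer_near_direction _ V finV Omega0 (- a) (-1).
  by rewrite sqrrN expr1n.
have [d vd Hd] := Ha _ e0.
exists (d + v); first lra.
exists B => psi; rewrite (_ : v - (d + v) = - d); last ring.
move=> /andP[dp pv].
have [r0 _ QE _] := H psi.
have aI : - a - e < ang psi < - a.
  have := Hd (- psi) _ _; rewrite opprK => h.
  by have /andP[? ?] := h ltac:(lra) ltac:(lra); apply/andP; split; lra.
apply: (exposes_dir QE r0 VB aI) => b /andP[ab be] p Vp.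
have := HB (- a - b) _ p Vp; rewrite mulN1r (_ : - a - (- a - b) = b); last ring.
by apply; apply/andP; split; lra.
Qed.

End polar.

(** * From the motion to the partition *)

Section assembly.
Context {R : realType}.

(** The polar angle in [ [0, 2 pi[ ] is unique: equal cosines and sines leave only
    one angle. *)
Lemma polar_inj (r1 r2 a1 a2 : R) : 0 < r1 -> 0 < r2 ->
  0 <= a1 < 2 * pi -> 0 <= a2 < 2 * pi -> polar_pt r1 a1 = polar_pt r2 a2 -> a1 = a2.
Proof.
move=> r10 r20 /andP[a10 a12] /andP[a20 a22] E.
have pi0 := pi_gt0 R.
have rE : r1 = r2 by rewrite -(radius_polar a1 (ltW r10)) E radius_polar// ltW.
move: E; rewrite rE /polar_pt => -[/(mulfI (lt0r_neq0 r20)) cE /(mulfI (lt0r_neq0 r20)) sE].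
have low (x y : R) : x <= pi -> pi < y -> 0 <= x -> y < 2 * pi -> sin x <> sin y.
  move=> xp py x0 y2 xy.
  have : 0 <= sin x by rewrite sin_ge0_pi// x0.
  have : 0 < sin (2 * pi - y) by rewrite sin_gt0_pi//; apply/andP; split; lra.
  rewrite sin_2pi_sub xy; lra.
have [p1|p1] := leP a1 pi; have [p2|p2] := leP a2 pi.
- by apply: (cos_inj _ _ cE); rewrite in_itv/= ?a10 ?a20.
- by case: (low a1 a2).
- by case: (low a2 a1).
- have : 2 * pi - a1 = 2 * pi - a2.
    by apply: cos_inj; rewrite ?cos_2pi_sub// in_itv/=; apply/andP; split; lra.
  lra.
Qed.

(** A boundary point determines its polar angle, hence the area of its sector,
    hence theta up to the period. *)
Lemma trig_point_inj (Omega : set (R * R)) (th1 th2 : R) P :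
  is_trig_point Omega (reduce_mod (period Omega) th1) P ->
  is_trig_point Omega (reduce_mod (period Omega) th2) P ->
  exists k : int, th1 = th2 + k%:~R * period Omega.
Proof.
move=> [_ [r1 [a1 [r10 a1I P1 A1]]]] [_ [r2 [a2 [r20 a2I P2 A2]]]].
have aE : a1 = a2 by apply: (polar_inj r10 r20) => //; rewrite -P1.
move: A2; rewrite -aE A1 => -[]; rewrite /reduce_mod => H.
exists (Num.floor (th1 / period Omega) - Num.floor (th2 / period Omega)).
rewrite intrB mulrBl.
have : (th1 - (Num.floor (th1 / period Omega))%:~R * period Omega) =
  (th2 - (Num.floor (th2 / period Omega))%:~R * period Omega) by lra.
lra.
Qed.

Definition const_mod_on (T : R) (theta : R -> R) c d : Prop :=
  exists g : R, {ae lebesgue_measure, forall t : R, t \in `]c, d[ ->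
    exists k : int, theta t = g + k%:~R * T}.

Lemma const_mod_on_sub T theta c d c' d' : c <= c' -> d' <= d ->
  const_mod_on T theta c d -> const_mod_on T theta c' d'.
Proof.
move=> cc dd [g H]; exists g; apply: ae_imp H => t H.
rewrite in_itv/= => /andP[ct td]; apply: H.
by rewrite in_itv/= (le_lt_trans cc ct) (lt_le_trans td dd).
Qed.

Lemma const_mod_on_class T theta (S : R -> Prop) c d :
  (forall x y, S x -> S y -> exists k : int, x = y + k%:~R * T) ->
  {ae lebesgue_measure, forall t : R, t \in `]c, d[ -> S (theta t)} ->
  const_mod_on T theta c d.
Proof.
move=> HS ae.
have [[g Sg]|nS] := pselect (exists g, S g).
  by exists g; apply: ae_imp ae => t H /H /HS; apply.
by exists 0; apply: ae_imp ae => t H /H St; case: nS; exists (theta t).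
Qed.

(** The conclusion of the theorem for the segment [ [a, s] ], as a property of
    [s]. *)
Definition class_partition (T : R) (theta : R -> R) a s : Prop :=
  exists (n : nat) (J : 'I_n -> interval R),
      partition [set: 'I_n] (fun i => [set` J i]) `[a, s] /\
      forall i, exists c : R, {ae lebesgue_measure, forall t : R, t \in J i ->
        exists k : int, theta t = c + k%:~R * T}.

Lemma class_partition0 T theta a : class_partition T theta a a.
Proof.
exists 1, (fun=> `[a, a]); split; last first.
  move=> i; exists (theta a); exists set0; split => //.
  move=> t /=; apply; rewrite in_itv/= => /le_anti ->.
  by exists 0; rewrite mul0r addr0.
split.
- apply/seteqP; split=> [t [i _]//|t tI]; by exists ord0.
- by move=> i j _ _ _; rewrite (ord1 i) (ord1 j).
- by move=> i _; exists a; rewrite /= in_itv/= lexx.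
Qed.

Lemma class_partition_ext T theta a s s' : a <= s -> s < s' ->
  class_partition T theta a s -> const_mod_on T theta s s' -> class_partition T theta a s'.
Proof.
move=> as_ ss' [n [J [[Jc Jt Jn] JT]]] [g /ae_itv_closed Hg].
pose J' (i : 'I_n.+1) := if unlift ord_max i is Some j then J j else `]s, s'].
have J'max : J' ord_max = `]s, s'] by rewrite /J' unlift_none.
have J'lift j : J' (lift ord_max j) = J j by rewrite /J' liftK.
have Jsub j t : t \in J j -> a <= t <= s.
  move=> tJ; have : cover [set: 'I_n] (fun i => [set` J i]) t by exists j.
  by rewrite Jc /= in_itv.
exists n.+1, J'; split; last first.
  move=> i; case: (unliftP ord_max i) => [j|] ->; first by rewrite J'lift.
  rewrite J'max; exists g; apply: ae_imp Hg => t H; rewrite in_itv/= => /andP[st ts].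
  by apply: H; rewrite in_itv/= ltW.
split.
- apply/seteqP; split=> [t [i _]|t].
    case: (unliftP ord_max i) => [j|] ->.
      rewrite J'lift /= => /Jsub/andP[h1 h2].
      by rewrite in_itv/= h1 (le_trans h2)// ltW.
    rewrite J'max /= !in_itv/= => /andP[h1 ->]; rewrite andbT.
    by rewrite (le_trans as_)// ltW.
  rewrite /= in_itv/= => /andP[at_ ts'].
  have [ts|st] := leP t s.
    have : [set` `[a, s]] t by rewrite /= in_itv/= at_.
    by rewrite -Jc => -[j _ tj]; exists (lift ord_max j) => //; rewrite J'lift.
  by exists ord_max => //; rewrite J'max /= in_itv/= st.
- apply/trivIsetP => i j _ _.
  case: (unliftP ord_max i) => [i'|] ->; case: (unliftP ord_max j) => [j'|] ->.
  + move=> ij; rewrite !J'lift; move/trivIsetP: Jt; apply=> //.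
    by apply: contra ij => /eqP ->.
  + move=> _; rewrite J'lift J'max; apply/seteqP; split=> // t [/= /Jsub/andP[_ ts]].
    by rewrite in_itv/= ltNge ts.
  + move=> _; rewrite J'lift J'max; apply/seteqP; split=> // t [/= + /Jsub/andP[_ ts]].
    by rewrite in_itv/= ltNge ts.
  + by rewrite eqxx.
- move=> i _; case: (unliftP ord_max i) => [j|] ->.
    by rewrite J'lift; exact: Jn.
  by rewrite J'max; exists s'; rewrite /= in_itv/= ss' lexx.
Qed.

Lemma trig_point_spec (Omega : set (R * R)) (th : R) : trig_point Omega th <> (0, 0) ->
  is_trig_point Omega (reduce_mod (period Omega) th) (trig_point Omega th).
Proof.
have [ex _|nex] := pselect (exists P, is_trig_point Omega (reduce_mod (period Omega) th) P).
  exact: (xgetPex (0, 0) ex).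
by rewrite {1}/trig_point xgetPN// => P HP; apply: nex; exists P.
Qed.

Section dynamics.
Variables (V : set (R * R)) (a b M L : R) (x dx theta : R -> R).
Hypothesis finV : finite_set V.
Let Omega : set (R * R) := smallest (@convex_set R (R * R)%type) V.
Hypothesis Omega0 : Omega° (0, 0).
Let K := polar_set Omega.
Let T := period Omega.
Hypothesis L0 : 0 <= L.
Hypothesis xM : forall s t, s \in `[a, b] -> t \in `[a, b] -> `|x s - x t| <= M * `|s - t|.
Hypothesis xd : forall t, t \in `]a, b[ -> is_derive t 1 x (dx t).
Hypothesis dxL : forall s t, s \in `]a, b[ -> t \in `]a, b[ -> `|dx s - dx t| <= L * `|s - t|.
Hypothesis acc : {ae lebesgue_measure, forall t : R, t \in `]a, b[ ->
    corresponds Omega (theta t) (x t) /\ is_derive t 1 dx (sinO Omega (theta t))}.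

Lemma correspondsE th psi : corresponds Omega th psi <->
  forall p, Omega p ->
    pairing (trig_point K psi) p <=
    pairing (trig_point K psi) (trig_point Omega th).
Proof.
rewrite /corresponds /cosO /sinO -/K.
by case: (trig_point K psi) => ? ?; case: (trig_point Omega th).
Qed.

Lemma polar_trig_neq0 psi : trig_point K psi <> (0, 0).
Proof.
have [_ [r [al [r0 _ -> _]]]] := polar_trig_point finV Omega0 psi.
rewrite /polar_pt => -[/eqP + /eqP]; rewrite !mulf_eq0 (gt_eqF r0)/= => /eqP c0 /eqP s0.
by have := cos2Dsin2 al; rewrite c0 s0 expr0n/= addr0; lra.
Qed.

(** A covector Q_psi is nonzero, so it is positive somewhere on a neighbourhood
    of 0 and its maximum over [Omega] is positive; hence P_theta is not the
    default value (0, 0). *)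
Lemma corresponds_trig th psi : corresponds Omega th psi ->
  is_trig_point Omega (reduce_mod (period Omega) th) (trig_point Omega th).
Proof.
move=> /correspondsE H.
have [p Op p0] := exists_pairing_gt0 Omega0 (@polar_trig_neq0 psi).
apply: trig_point_spec => P0; have := lt_le_trans p0 (H p Op).
by rewrite P0 /pairing/= !mulr0 addr0 ltxx.
Qed.

Lemma corresponds_exposes th psi B : corresponds Omega th psi ->
  exposes V psi B -> trig_point Omega th = B.
Proof.
move=> c; apply; last exact/correspondsE.
by have [[]] := corresponds_trig c.
Qed.

(** A point of the x-axis at which a given covector takes its positive maximum
    is unique, since the first coordinate of the covector cannot vanish. *)
Lemma corresponds_zero th1 th2 psi : corresponds Omega th1 psi -> sinO Omega th1 = 0 ->
  corresponds Omega th2 psi -> sinO Omega th2 = 0 ->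
  exists k : int, th1 = th2 + k%:~R * T.
Proof.
have key th : corresponds Omega th psi -> closure Omega (trig_point Omega th).
  by move=> c; have [[]] := corresponds_trig c.
move=> c1 s1 c2 s2.
have := corresponds_trig c1; suff -> : trig_point Omega th1 = trig_point Omega th2.
  by move=> t1; apply: trig_point_inj t1 (corresponds_trig c2).
have le th th' : corresponds Omega th psi -> corresponds Omega th' psi ->
    pairing (trig_point K psi) (trig_point Omega th) <=
    pairing (trig_point K psi) (trig_point Omega th').
  move=> c c'; apply: hull_le (key _ c) => p Vp.
  by move/correspondsE: c'; apply; exact: vertices_sub_hull.
have E : pairing (trig_point K psi) (trig_point Omega th1) =
    pairing (trig_point K psi) (trig_point Omega th2) by apply/eqP; rewrite eq_le !le.
have [p Op p0] := exists_pairing_gt0 Omega0 (@polar_trig_neq0 psi).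
have m0 := lt_le_trans p0 ((correspondsE _ _).1 c1 p Op).
move: s1 s2 E m0; rewrite /sinO.
case: (trig_point Omega th1) => u1 u2; case: (trig_point Omega th2) => v1 v2 /= -> ->.
rewrite /pairing/= !mulr0 !addr0 => E m0; congr (_, _); apply: mulfI E.
by apply/eqP => q0; move: m0; rewrite q0 mul0r ltxx.
Qed.

Lemma exposes_both_sides v : exists2 e, 0 < e & exists Bn Bp,
  (forall psi, v - e < psi < v -> exposes V psi Bn) /\
  (forall psi, v < psi < v + e -> exposes V psi Bp).
Proof.
have [e1 e10 [Bp Hp]] := exposes_right finV Omega0 v.
have [e2 e20 [Bn Hn]] := exposes_left finV Omega0 v.
exists (Num.min e1 e2); first by rewrite lt_min e10.
have le1 : Num.min e1 e2 <= e1 by rewrite ge_min lexx.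
have le2 : Num.min e1 e2 <= e2 by rewrite ge_min lexx orbT.
exists Bn, Bp; split=> psi /andP[h1 h2]; [apply: Hn|apply: Hp]; apply/andP; split; lra.
Qed.

Lemma ae_exposed c d B : a <= c -> d <= b ->
  (forall t, t \in `]c, d[ -> exposes V (x t) B) ->
  {ae lebesgue_measure, forall t : R, t \in `]c, d[ ->
    (is_trig_point Omega (reduce_mod T (theta t)) B) /\ is_derive t 1 dx B.2}.
Proof.
move=> ac db H; apply: ae_imp acc => t Ht tcd.
have tab : t \in `]a, b[.
  by move: tcd; rewrite !in_itv/= => /andP[? ?]; apply/andP; split; lra.
have [c1 d1] := Ht tab.
have E := corresponds_exposes c1 (H t tcd).
split; first by rewrite -E; exact: corresponds_trig c1.
by rewrite -E.
Qed.

Lemma affine_exposed c d B : a < c -> d < b ->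
  (forall t, t \in `]c, d[ -> exposes V (x t) B) ->
  forall s t, s \in `[c, d] -> t \in `[c, d] -> dx t - dx s = B.2 * (t - s).
Proof.
move=> ac db H s t sI tI.
pose h (z : R) : R := dx z - B.2 * z.
suff : h s = h t by rewrite /h; lra.
have sub z : z \in `[c, d] -> z \in `]a, b[.
  by rewrite !in_itv/= => /andP[? ?]; apply/andP; split; lra.
apply: (@lipschitz_ae_derive0_cst _ h (L + `|B.2|) c d) sI tI.
- by rewrite addr_ge0.
- move=> y z yI zI; rewrite /h.
  have -> : dx y - B.2 * y - (dx z - B.2 * z) = (dx y - dx z) - B.2 * (y - z) by ring.
  rewrite mulrDl (le_trans (ler_normB _ _))// lerD ?normrM//.
  by apply: dxL; exact: sub.
- apply: ae_imp (ae_exposed (ltW ac) (ltW db) H) => z Hz zI.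
  have [_ dz] := Hz zI.
  rewrite /h; apply: is_derive_eq; rewrite /GRing.scale/= mulr1; ring.
Qed.

(** The trajectory seen from the value [v]: above [v] it is driven by the vertex
    [Bp] and below by the vertex [Bn]. *)
Lemma solution_relay l r e v Bn Bp : a <= l -> r <= b ->
  (forall t, t \in `[l, r] -> `|x t - v| < e) ->
  (forall psi, v - e < psi < v -> exposes V psi Bn) ->
  (forall psi, v < psi < v + e -> exposes V psi Bp) ->
  relay l r L M Bn.2 Bp.2 (fun t => x t - v) dx.
Proof.
move=> al rb xv Hn Hp.
have sub z : z \in `[l, r] -> z \in `[a, b].
  by rewrite !in_itv/= => /andP[? ?]; apply/andP; split; lra.
have subo z : z \in `]l, r[ -> z \in `]a, b[.
  by rewrite !in_itv/= => /andP[? ?]; apply/andP; split; lra.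
split=> //.
- move=> s t /sub sI /sub tI.
  by rewrite (_ : x s - v - (x t - v) = x s - x t) ?xM//; ring.
- move=> t /subo/xd ?; apply: is_derive_eq; ring.
- by move=> s t /subo sI /subo tI; exact: dxL.
- move=> c d lc dr pos; apply: affine_exposed; [lra|lra|].
  move=> t tcd; apply: Hp.
  have : `|x t - v| < e.
    by apply: xv; move: tcd; rewrite !in_itv/= => /andP[? ?]; apply/andP; split; lra.
  by rewrite ltr_norml => /andP[? ?]; have := pos t tcd => ?; apply/andP; split; lra.
- move=> c d lc dr neg; apply: affine_exposed; [lra|lra|].
  move=> t tcd; apply: Hn.
  have : `|x t - v| < e.
    by apply: xv; move: tcd; rewrite !in_itv/= => /andP[? ?]; apply/andP; split; lra.
  by rewrite ltr_norml => /andP[? ?]; have := neg t tcd => ?; apply/andP; split; lra.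
Qed.

(** When [x] stays at [v] its velocity and its acceleration vanish, so
    P_theta is on the x-axis almost everywhere and [corresponds_zero] applies;
    otherwise a single vertex is exposed. *)
Lemma const_mod_on_sign c d e v Bn Bp : a <= c -> d <= b ->
  (forall t, t \in `]c, d[ -> `|x t - v| < e) ->
  (forall psi, v - e < psi < v -> exposes V psi Bn) ->
  (forall psi, v < psi < v + e -> exposes V psi Bp) ->
  [\/ forall t, t \in `]c, d[ -> x t - v = 0, forall t, t \in `]c, d[ -> 0 < x t - v
      | forall t, t \in `]c, d[ -> x t - v < 0] ->
  const_mod_on T theta c d.
Proof.
move=> ac db xv Hn Hp.
have subo z : z \in `]c, d[ -> z \in `]a, b[.
  by rewrite !in_itv/= => /andP[? ?]; apply/andP; split; lra.
have side B : (forall t, t \in `]c, d[ -> exposes V (x t) B) -> const_mod_on T theta c d.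
  move=> H.
  apply: (@const_mod_on_class _ _ (fun th => is_trig_point Omega (reduce_mod T th) B)).
    by move=> y z; exact: trig_point_inj.
  by apply: ae_imp (ae_exposed ac db H) => t Ht /Ht[].
have near_cst (f : R -> R) (k t : R) : t \in `]c, d[ ->
    (forall z, z \in `]c, d[ -> f z = k) -> is_derive t 1 f 0.
  move=> tI fk; apply: (@near_eq_is_derive _ _ _ (cst k)) => //.
  near=> z; rewrite /= fk//.
  by near: z; apply: near_in_itvoo.
case=> H; last 2 first.
- apply: (side Bp) => t tI; apply: Hp; have := H t tI; have := xv t tI.
  by rewrite ltr_norml => /andP[? ?] ?; apply/andP; split; lra.
- apply: (side Bn) => t tI; apply: Hn; have := H t tI; have := xv t tI.
  by rewrite ltr_norml => /andP[? ?] ?; apply/andP; split; lra.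
have xE t : t \in `]c, d[ -> x t = v by move=> /H; lra.
have dx0 t : t \in `]c, d[ -> dx t = 0.
  move=> tI; have D0 := near_cst x v t tI xE; have D1 := xd (subo _ tI).
  by rewrite -(@derive_val _ _ _ _ _ _ _ D1) (@derive_val _ _ _ _ _ _ _ D0).
apply: (@const_mod_on_class _ _ (fun th => corresponds Omega th v /\ sinO Omega th = 0)).
  by move=> y z [c1 s1] [c2 s2]; exact: corresponds_zero c1 s1 c2 s2.
apply: ae_imp acc => t Ht tI; have [c1 D1] := Ht (subo _ tI).
split; first by rewrite -(xE t tI).
have D0 := near_cst dx 0 t tI dx0.
by rewrite -(@derive_val _ _ _ _ _ _ _ D1) (@derive_val _ _ _ _ _ _ _ D0).
Unshelve. all: by end_near. Qed.

Lemma solution_near s e : a <= s <= b -> 0 < e -> exists2 h, 0 < h &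
  forall t, t \in `[a, b] -> `|t - s| < h -> `|x t - x s| < e.
Proof.
move=> sI e0; have M0 : 0 < `|M| + 1 by rewrite ltr_wpDl.
exists (e / (`|M| + 1)); first by rewrite divr_gt0.
move=> t tI; rewrite ltr_pdivlMr// => h.
apply: le_lt_trans (xM tI _) _; first by rewrite in_itv.
apply: le_lt_trans h; rewrite mulrC ler_wpM2l//.
by rewrite (le_trans (ler_norm _))// lerDl.
Qed.

Lemma const_mod_on_right s : a <= s < b -> exists2 d, s < d <= b & const_mod_on T theta s d.
Proof.
move=> /andP[as_ sb]; have [e e0 [Bn [Bp [Hn Hp]]]] := exposes_both_sides (x s).
have [|h h0 Hh] := solution_near (s := s) _ e0; first by rewrite as_ ltW.
pose r := Num.min b (s + h / 2).
have sr : s < r by rewrite lt_min sb ltrDl divr_gt0.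
have rb : r <= b by rewrite ge_min lexx.
have rh : r <= s + h / 2 by rewrite ge_min lexx orbT.
have close t : t \in `[s, r] -> `|x t - x s| < e.
  rewrite in_itv/= => /andP[st tr]; apply: Hh.
    by rewrite in_itv/=; apply/andP; split; lra.
  by rewrite ger0_norm; lra.
have rel := solution_relay as_ rb close Hn Hp.
have [|d /andP[sd dr] H] := relay_trichotomy rel sr; first by rewrite subrr.
exists d; first by rewrite sd (le_trans dr).
apply: (const_mod_on_sign as_ (le_trans dr rb) _ Hn Hp H) => t; rewrite in_itv/= => /andP[? ?].
by apply: close; rewrite in_itv/=; apply/andP; split; lra.
Qed.

Lemma const_mod_on_left s : a < s <= b -> exists2 d, a <= d < s & const_mod_on T theta d s.
Proof.
move=> /andP[as_ sb]; have [e e0 [Bn [Bp [Hn Hp]]]] := exposes_both_sides (x s).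
have [|h h0 Hh] := solution_near (s := s) _ e0; first by rewrite (ltW as_).
pose l := Num.max a (s - h / 2).
have ls : l < s by rewrite gt_max as_/= ltrBlDr ltrDl divr_gt0.
have al : a <= l by rewrite le_max lexx.
have lh : s - h / 2 <= l by rewrite le_max lexx orbT.
have close t : t \in `[l, s] -> `|x t - x s| < e.
  rewrite in_itv/= => /andP[lt ts]; apply: Hh.
    by rewrite in_itv/=; apply/andP; split; lra.
  by rewrite ler0_norm; lra.
have rel := relay_rev (solution_relay al sb close Hn Hp).
have [||d /andP[sd dl] H] := relay_trichotomy rel.
- by rewrite ltrN2.
- by rewrite opprK subrr.
exists (- d); first by apply/andP; split; lra.
apply: (@const_mod_on_sign _ _ e (x s) Bn Bp) => //; first lra.
  move=> t; rewrite in_itv/= => /andP[? ?]; apply: close.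
  by rewrite in_itv/=; apply/andP; split; lra.
have rev t : t \in `]- d, s[ -> - t \in `]- s, d[.
  by rewrite !in_itv/= => /andP[? ?]; apply/andP; split; lra.
by case: H => H; [apply: Or31|apply: Or32|apply: Or33] => t /rev/H; rewrite opprK.
Qed.

Lemma partition_of_solution : a <= b -> class_partition T theta a b.
Proof.
move=> ab; apply: (@real_induction _ (class_partition T theta a) a b ab).
- exact: class_partition0.
- move=> s /andP[as_ sb] Ds; have [|d /andP[sd db] g] := @const_mod_on_right s.
    by rewrite as_.
  by exists d; rewrite ?sd//; exact: class_partition_ext g.
- move=> s /andP[as_ sb] Dapp; have [|d /andP[ad ds] g] := @const_mod_on_left s.
    by rewrite as_.
  have [|z [az dz zs Dz]] := Dapp (s - d); first by rewrite subr_gt0.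
  apply: (class_partition_ext az zs Dz); apply: const_mod_on_sub g => //; lra.
Qed.

End dynamics.
End assembly.

Lemma lipschitz_bound (R : realType) (A : set R) (f : R -> R) : [lipschitz f x | x in A] ->
  exists2 M, 0 <= M & forall s t, A s -> A t -> `|f s - f t| <= M * `|s - t|.
Proof.
move=> [M [_ H]]; exists (`|M| + 1); first by rewrite addr_ge0.
move=> s t As At; have := H (`|M| + 1) _ (s, t) (conj As At); apply.
by rewrite (le_lt_trans (ler_norm _))// ltrDl.
Qed.

Theorem theorem3 (R : realType) (Omega : set (R * R)) (I : interval R)
    (thetao theta : R -> R) :
  convex_polygon Omega ->
  Omega° (0, 0) ->
  pendulum_solution Omega I thetao ->
  accompanies Omega I thetao theta ->
  ae_piecewise_constant_mod (period Omega) I theta.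
Proof.
move=> [V [finV ->]] O0 [/lipschitz_bound[M _ xM] xder /lipschitz_bound[L L0 dxL] _] acc a b ab abI.
have sub t : t \in `]a, b[ -> [set` I]° t.
  move=> tab; have oab : open (`]a, b[%classic : set R) by exact: interval_open.
  apply: (@interiorS _ _ _ _ t (open_nbhs_nbhs (conj oab tab))) => z /= zab.
  by apply: abI; exact: subset_itv_oo_cc zab.
apply: (@partition_of_solution _ V a b M L thetao (derive1 thetao) theta) => //.
- by move=> s t sI tI; apply: xM; exact: abI.
- by move=> t /sub/xder D; rewrite derive1E; exact: derivableP.
- by move=> s t /sub sI /sub tI; exact: dxL.
- apply: ae_imp acc => t H tab; apply: H.
  by apply: abI; exact: subset_itv_oo_cc tab.
Qed.
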